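(* Let $K\in\mathbb{K}^{p,q}$, let $\mathcal{H}$ satisfy the assumptions in the context with constant $c_1$, let $\gamma>0$, let $C_1=O(1)$ be a fixed constant, and put $\kappa=1+2c_1\gamma+2C_1\gamma$. There is a constant $C$, independent of $\varepsilon,\tau$ and $T$ (but possibly depending on $\mathcal{H},p,q,K,\gamma$ and the fixed constant $C_1$), such that the following holds. Let $N\ge1$ be an integer, $\triangle t=T/N$ with $\triangle t\le\frac{2}{3\kappa}$, $t_n=n\triangle t$, $t_{n+1/2}=(t_n+t_{n+1})/2$, and let $0<\varepsilon<\tau<\triangle t$, $\varepsilon<1$. Let $\mathbf{F}$ be the upscaled flux defined in the context (exact solution of the micro problem). Suppose $\{\mathbf{M}_n\}_{n=0}^N\subset\mathbb{R}^3$ satisfies, for $0\le n\le N-1$ and with $\mathbf{M}_{n+1/2}=\tfrac12(\mathbf{M}_n+\mathbf{M}_{n+1})$, $$\mathbf{M}_{n+1}=\mathbf{M}_n+\triangle t\,\mathbf{F}(t_{n+1/2},\mathbf{M}_{n+1/2})+\gamma\,\triangle t\,\mathbf{M}_{n+1/2}\times\mathbf{F}(t_{n+1/2},\mathbf{M}_{n+1/2}),$$ and $\{\bar{\mathbf{m}}_n\}_{n=0}^N\subset\mathbb{R}^3$ satisfies, for $0\le n\le N-1$ and with $\bar{\mathbf{m}}_{n+1/2}=\tfrac12(\bar{\mathbf{m}}_n+\bar{\mathbf{m}}_{n+1})$, $$\bar{\mathbf{m}}_{n+1}=\bar{\mathbf{m}}_n-\triangle t\,\bar{\mathcal{H}}(t_{n+1/2})\bar{\mathbf{m}}_{n+1/2}+\triangle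 t\,\mathbf{N}_\gamma[\bar{\mathbf{m}}_{n+1/2}],\qquad \mathbf{N}_\gamma[\mathbf{v}]:=-\gamma\,\mathbf{v}\times\big(\bar{\mathcal{H}}(t_{n+1/2})\mathbf{v}\big),$$ with the same initial value $\mathbf{M}_0=\bar{\mathbf{m}}_0$, $|\mathbf{M}_0|=1$. Let $\mathbf{e}_n:=\mathbf{M}_n-\bar{\mathbf{m}}_n$ and $\mathbf{e}_{n+1/2}:=\tfrac12(\mathbf{e}_n+\mathbf{e}_{n+1})$. Assume that for all $0\le n\le N-1$ one has $|\mathbf{M}_{n+1/2}|\le C_1$ and $$\big\langle \partial_{\mathbf{M}}\mathbf{N}_\gamma(\bar{\mathbf{m}}_{n+1/2}+\theta\,\mathbf{e}_{n+1/2})\,\mathbf{e}_{n+1/2},\,\mathbf{e}_{n+1/2}\big\rangle\le\gamma c_1|\mathbf{e}_{n+1/2}|^2\qquad\text{for all }\theta\in[0,1],$$ where $\partial_{\mathbf{M}}\mathbf{N}_\gamma(\mathbf{v})$ denotes the Jacobian matrix of $\mathbf{v}\mapsto\mathbf{N}_\gamma[\mathbf{v}]$ (at the time $t_{n+1/2}$). Then $$|\mathbf{e}_N|\le C\sqrt{T}\left(\tau+\left(\frac{\varepsilon}{\tau}\right)^{q+2}\right)e^{\frac{3\kappa}{4}T}\max_{0\le n\le N-1}|\mathbf{M}_{n+1/2}|.$$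
   Context: $|\cdot|$ and $\langle\cdot,\cdot\rangle$ are the Euclidean norm and inner product on $\mathbb{R}^3$. Field: $T>0$ and $\mathcal{H}:[0,T]\times\mathbb{R}\to\mathbb{R}^{3\times3}$ is a skew-symmetric matrix function of the form $$\mathcal{H}=\begin{pmatrix}0&H_3&-H_2\\-H_3&0&H_1\\H_2&-H_1&0\end{pmatrix}$$ (so $\mathcal{H}\mathbf{v}=\mathbf{v}\times\mathbf{H}$ with $\mathbf{H}=(H_1,H_2,H_3)$), such that $\mathcal{H}(t,\cdot)$ is $1$-periodic, its entries belong to $C^\infty([0,T]\times[0,1])$, and $c_1$ is a constant with $|\partial_t^k\mathcal{H}(t,s)\mathbf{v}|\le c_1|\mathbf{v}|$ for $k=0,1$, all $\mathbf{v}\in\mathbb{R}^3$, $t\in[0,T]$, $s\in\mathbb{R}$ ($\partial_t$ is the derivative in the first argument). Put $\bar{\mathcal{H}}(t):=\int_0^1\mathcal{H}(t,s)\,ds$. Kernels: for integers $p\ge 0$, $q\ge-1$, $K\in\mathbb{K}^{p,q}$ means that $K:\mathbb{R}\to\mathbb{R}$ has compact support in $[-1/2,1/2]$, $K(t)=K(-t)$, the weak derivative $K^{(q+1)}$ belongs to $BV(\mathbb{R})$, and $\int_{\mathbb{R}}K(t)\,dt=1$, $\int_{\mathbb{R}}K(t)t^r\,dt=0$ for integers $0<r\le p$. The scaled kernel is $K_\tau(t):=\frac1\tau K(t/\tau)$. Upscaled flux: for $t_a$ with $[t_a-\tau/2,t_a+\tau/2]\subset[0,T]$ and $\mathbf{M}\in\mathbb{R}^3$,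 let $\mathbf{m}^\varepsilon$ be the exact solution of $\frac{d}{dt}\mathbf{m}^\varepsilon(t)=-\mathcal{H}(t,t/\varepsilon)\mathbf{m}^\varepsilon(t)$ on $[t_a-\tau/2,t_a+\tau/2]$ with $\mathbf{m}^\varepsilon(t_a)=\mathbf{M}$ (solved forward and backward from $t_a$), and set $$\mathbf{F}(t_a,\mathbf{M}):=\int_{t_a-\tau/2}^{t_a+\tau/2}K_\tau(s-t_a)\frac{d}{ds}\mathbf{m}^\varepsilon(s)\,ds.$$ *)

(* Defs.v *)
From HB Require Import structures.
From mathcomp Require Import all_boot all_order all_algebra.
From mathcomp Require Import all_classical all_reals all_analysis.
Import Order.TTheory GRing.Theory Num.Theory.
Import numFieldNormedType.Exports.

Set Implicit Arguments.
Unset Strict Implicit.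
Unset Printing Implicit Defensive.

Local Open Scope classical_set_scope.
Local Open Scope ring_scope.

(* Euclidean geometry of R^3; the library norm on 'cV_3 is the sup norm. *)

Definition dot (R : realType) (u v : 'cV[R]_3) : R := \sum_i u i 0 * v i 0.

Definition enorm (R : realType) (u : 'cV[R]_3) : R := Num.sqrt (dot u u).

(* Indices are added in 'I_3, i.e. modulo 3. *)
Definition cross (R : realType) (u v : 'cV[R]_3) : 'cV[R]_3 :=
  \col_(i < 3) (u (i + 1) 0 * v (i + 2) 0 - u (i + 2) 0 * v (i + 1) 0).

Definition field_mx (R : realType) (h1 h2 h3 : R) : 'M[R]_3 :=
  \matrix_(i, j) nth 0 (nth [::] [:: [::    0;   h3; - h2];
                                     [:: - h3;    0;   h1];
                                     [::   h2; - h1;    0]] i) j.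

Lemma field_mxE (R : realType) (h1 h2 h3 : R) (v : 'cV[R]_3) :
  field_mx h1 h2 h3 *m v = cross v (\col_i nth 0 [:: h1; h2; h3] i).
Proof.
apply/matrixP => i j; rewrite ord1 !mxE !big_ord_recl big_ord0 !mxE /=.
have vE (k l : 'I_3) : nat_of_ord k = l -> v k 0 = v l 0 by move=> /val_inj ->.
case: i => -[|[|[|//]]] Hi /=; rewrite !mul0r ?mulNr ?addr0 ?add0r.
- by rewrite [h3 * _]mulrC [h2 * _]mulrC; congr (_ * _ - _ * _); apply: vE.
- rewrite [h3 * _]mulrC [h1 * _]mulrC addrC.
  by congr (_ * _ - _ * _); apply: vE.
- by rewrite [h2 * _]mulrC [h1 * _]mulrC; congr (_ * _ - _ * _); apply: vE.
Qed.

Definition jacobian_mx (R : realType) (f : 'cV[R]_3 -> 'cV[R]_3)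
    (v : 'cV[R]_3) : 'M[R]_3 :=
  \matrix_(i, j) ('D_(delta_mx j 0) f v) i 0.

(* l is the derivative at x of the restriction of f to D; one-sided when D is
   an interval and x one of its endpoints. *)
Definition is_derive_on (R : realType) (V : normedModType R) (D : set R)
    (f : R -> V) (x : R) (l : V) : Prop :=
  (y - x)^-1 *: (f y - f x) @[y --> within D x^'] --> l.

(* f is C^infinity on the closed rectangle [a, b] x [c, d], up to the boundary;
   D i j is the partial derivative of order i in the first variable and j in
   the second one. *)
Definition smooth_on_rect (R : realType) (a b c d : R) (f : R -> R -> R) :
    Prop :=
  exists D : nat -> nat -> R -> R -> R,
    {in `[a, b] & `[c, d], forall t s, D 0%N 0%N t s = f t s} /\
    forall i j : nat,
      {within `[a, b] `*` `[c, d], continuous (fun x : R * R => D i j x.1 x.2)}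
      /\ {in `[a, b] & `[c, d], forall t s,
           is_derive_on `[a, b] (fun t' => D i j t' s) t (D i.+1 j t s) /\
           is_derive_on `[c, d] (fun s' => D i j t s') s (D i j.+1 t s)}.

(* The values H t s for t outside [0, T] are irrelevant. *)
Definition admissible_field (R : realType) (T c1 : R)
    (H : R -> R -> 'M[R]_3) : Prop :=
  [/\ {in `[0, T], forall t s, exists h1 h2 h3, H t s = field_mx h1 h2 h3},
      {in `[0, T], forall t s, H t (s + 1) = H t s},
      forall i j, smooth_on_rect 0 T 0 1 (fun t s => H t s i j),
      {in `[0, T], forall t s v, enorm (H t s *m v) <= c1 * enorm v} &
      exists dtH : R -> R -> 'M[R]_3, {in `[0, T], forall t s,
        is_derive_on `[0, T] (fun t' => H t' s) t (dtH t s) /\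
        forall v, enorm (dtH t s *m v) <= c1 * enorm v}].

Definition avg_field (R : realType) (H : R -> R -> 'M[R]_3) (t : R) :
    'M[R]_3 :=
  \matrix_(i, j) \int[lebesgue_measure]_(s in `[0, 1]) H t s i j.

Definition Ngamma (R : realType) (gamma : R) (H : R -> R -> 'M[R]_3) (t : R)
    (v : 'cV[R]_3) : 'cV[R]_3 :=
  - (gamma *: cross v (avg_field H t *m v)).

Definition topological_support (R : realType) (f : R -> R) : set R :=
  closure [set x | f x != 0].

Definition test_function (R : realType) (phi : R -> R) : Prop :=
  compact (topological_support phi) /\
  forall n x, derivable (derive1n n phi) x 1.

Definition is_weak_derivative (R : realType) (k : nat) (f g : R -> R) : Prop :=
  [/\ locally_integrable setT f, locally_integrable setT g &
      forall phi, test_function phi ->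
        \int[lebesgue_measure]_x (f x * derive1n k phi x) =
        (-1) ^+ k * \int[lebesgue_measure]_x (g x * phi x)].

Definition total_variation_line (R : realType) (g : R -> R) : \bar R :=
  ereal_sup [set (\int[lebesgue_measure]_x (g x * derive1 phi x))%:E | phi in
    [set phi : R -> R | [/\ compact (topological_support phi),
       forall x, derivable phi x 1, continuous (derive1 phi) &
       forall x, `|phi x| <= 1]]].

Definition BV_line (R : realType) (g : R -> R) : Prop :=
  lebesgue_measure.-integrable setT (EFin \o g) /\
  (total_variation_line g < +oo)%E.

Definition kernel_class (R : realType) (p : nat) (q : int) (K : R -> R) :
    Prop :=
  [/\ -1 <= q,
      topological_support K `<=` `[- 2^-1, 2^-1],
      forall t, K t = K (- t),
      exists2 g, is_weak_derivative (absz (q + 1)) K g & BV_line g &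
      \int[lebesgue_measure]_t K t = 1 /\
      forall r : nat, (0 < r <= p)%N ->
        \int[lebesgue_measure]_t (K t * t ^+ r) = 0].

Definition scaled_kernel (R : realType) (K : R -> R) (tau t : R) : R :=
  tau^-1 * K (t / tau).

(* f is the flux F(ta, M); m is the micro solution and dm its derivative. *)
Definition is_upscaled_flux (R : realType) (H : R -> R -> 'M[R]_3)
    (K : R -> R) (eps tau ta : R) (M f : 'cV[R]_3) : Prop :=
  let I := `[ta - tau / 2, ta + tau / 2] in
  exists m dm : R -> 'cV[R]_3,
    [/\ m ta = M,
        {in I, forall t, is_derive_on [set` I] m t (dm t)},
        {in I, forall t, dm t = - (H t (t / eps) *m m t)} &
        f = \col_i \int[lebesgue_measure]_(s in [set` I])
              (scaled_kernel K tau (s - ta) * dm s i 0)].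

Definition midpt (R : realType) (V : lmodType R) (x : nat -> V) (n : nat) : V :=
  2^-1 *: (x n + x n.+1).

(* Main.v *)
Require Import Defs.
From HB Require Import structures.
From mathcomp Require Import all_boot all_order all_algebra.
From mathcomp Require Import all_classical all_reals all_analysis.
From mathcomp Require Import measurable_realfun ring lra.
Import Order.TTheory GRing.Theory Num.Theory.
Import numFieldNormedType.Exports.

Set Implicit Arguments.
Unset Strict Implicit.
Unset Printing Implicit Defensive.

Local Open Scope classical_set_scope.
Local Open Scope ring_scope.

(** The flux error is [F(t, M) + avg H(t) M = O(tau + (eps/tau)^(q+2)) |M|]:
    skew-symmetry makes the micro solution norm-preserving and hence Lipschitz,
    so up to O(tau) the micro solution and the slow argument of [H] are frozen
    at [t].  What is left is [K] tested against a 1-periodic function of mean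
    zero with period [eps/tau]; moving q+1 derivatives onto [K] in the weak
    sense and one more through the total variation of [K^(q+1)], each time
    against a bounded periodic primitive, gains [(eps/tau)^(q+2)].  Test
    functions must be smooth while the field is only continuous across integer
    fast times, so the fast profile is first replaced by a polynomial
    (Weierstrass), cut off outside the support of [K].

    For the global error, take the inner product of the difference of the two
    schemes with the midpoint error.  The averaged field drops out by skewness;
    the nonlinearity is quadratic, so its increment is exactly its Jacobian at
    the middle of the segment (theta = 1/2) applied to the error.  The discrete
    Gronwall lemma closes with (1 + x) / (1 - x) <= exp (3 x) on [0, 1/3]. *)

(** * Euclidean geometry of the midpoint scheme *)

Section euclid.
Variable R : realType.
Implicit Types u v w : 'cV[R]_3.

Lemma cV3P u v : u 0 0 = v 0 0 -> u 1 0 = v 1 0 -> u 2 0 = v 2 0 -> u = v.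
Proof.
move=> h0 h1 h2; apply/matrixP => i j; rewrite ord1.
by case: i => -[|[|[|//]]] Hi;
  [move: h0|move: h1|move: h2]; congr (u _ _ = v _ _); apply: val_inj.
Qed.

Lemma sum3 (f : 'I_3 -> R) : \sum_i f i = f 0 + f 1 + f 2.
Proof.
rewrite !big_ord_recl big_ord0 addr0 addrA.
by congr (_ + _ + _); congr (f _); apply: val_inj.
Qed.

Lemma dotE u v : dot u v = u 0 0 * v 0 0 + u 1 0 * v 1 0 + u 2 0 * v 2 0.
Proof. exact: sum3. Qed.

Lemma crossE u v :
  ((cross u v 0 0 = u 1 0 * v 2 0 - u 2 0 * v 1 0) *
   (cross u v 1 0 = u 2 0 * v 0 0 - u 0 0 * v 2 0) *
   (cross u v 2 0 = u 0 0 * v 1 0 - u 1 0 * v 0 0))%type.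
Proof.
by do 2?split; rewrite mxE; congr (_ * _ - _ * _);
  congr (_ _ 0); apply: val_inj.
Qed.

Lemma dot_ge0 u : 0 <= dot u u.
Proof. by rewrite dotE -!expr2 !addr_ge0 ?sqr_ge0. Qed.

Lemma enorm_ge0 u : 0 <= enorm u. Proof. exact: sqrtr_ge0. Qed.

Lemma enorm_sqr u : enorm u ^+ 2 = dot u u.
Proof. by rewrite sqr_sqrtr ?dot_ge0. Qed.

Lemma enorm_le u b : 0 <= b -> dot u u <= b ^+ 2 -> enorm u <= b.
Proof. by move=> b0 ub; rewrite -(ger0_norm b0) -sqrtr_sqr ler_wsqrtr. Qed.

(** Lagrange's identity. Dropping one of the two squares on the left gives the cross product bound
    or Cauchy-Schwarz. *)
Lemma dot_cross_sqr u v :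
  dot (cross u v) (cross u v) + dot u v ^+ 2 = dot u u * dot v v.
Proof. by rewrite !dotE !crossE; ring. Qed.

Lemma enorm_cross u v : enorm (cross u v) <= enorm u * enorm v.
Proof.
apply: enorm_le; first by rewrite mulr_ge0 ?enorm_ge0.
by rewrite exprMn !enorm_sqr -dot_cross_sqr lerDl sqr_ge0.
Qed.

Lemma dot_le u v : dot u v <= enorm u * enorm v.
Proof.
apply: le_trans (ler_norm _) _.
rewrite -(ger0_norm (mulr_ge0 (enorm_ge0 u) (enorm_ge0 v))).
rewrite -ler_sqr ?nnegrE ?normr_ge0// !real_normK ?num_real//.
by rewrite exprMn !enorm_sqr -dot_cross_sqr lerDr dot_ge0.
Qed.

Lemma entry_le_enorm u i : `|u i 0| <= enorm u.
Proof.
rewrite -ler_sqr ?nnegrE ?normr_ge0 ?enorm_ge0// real_normK ?num_real//.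
rewrite enorm_sqr /dot (bigD1 i)//= -expr2 lerDl sumr_ge0// => j _.
by rewrite -expr2 sqr_ge0.
Qed.

(** The constant 2 is a rational bound for the sharp factor, the square root of 3. *)
Lemma enorm_le_entries u b : (forall i, `|u i 0| <= b) -> enorm u <= 2 * b.
Proof.
move=> ub; have b0 : 0 <= b by apply: le_trans (ub 0).
have sq i : u i 0 * u i 0 <= b ^+ 2.
  by rewrite -expr2 -[u i 0 ^+ 2]real_normK ?num_real// ler_sqr ?nnegrE.
apply: enorm_le; first by rewrite mulr_ge0.
rewrite dotE; have := sq 0; have := sq 1; have := sq 2.
have : 0 <= b ^+ 2 by exact: sqr_ge0.
by set z := b ^+ 2; rewrite exprMn -/z; lra.
Qed.

(** [Ngamma] with the averaged matrix abstracted to [A], which displays it as a homogeneous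
    quadratic map of [v]. *)
Definition cross_quad (g : R) (A : 'M[R]_3) v := - (g *: cross v (A *m v)).

Definition cross_quad_lin (g : R) (A : 'M[R]_3) v w :=
  - (g *: (cross w (A *m v) + cross v (A *m w))).

Lemma cross_quadDZ (g : R) (A : 'M[R]_3) v w (h : R) :
  cross_quad g A (h *: w + v) =
  cross_quad g A v + h *: (cross_quad_lin g A v w + h *: cross_quad g A w).
Proof.
rewrite /cross_quad /cross_quad_lin mulmxDr -scalemxAr.
by apply: cV3P; rewrite !(crossE, mxE); ring.
Qed.

Lemma derive_cross_quad (g : R) (A : 'M[R]_3) v w :
  'D_w (cross_quad g A) v = cross_quad_lin g A v w.
Proof.
apply: cvg_lim => //.
(* By the exact expansion [cross_quadDZ], the difference quotient coincides with this affine
   function of [h] for [h != 0]. *)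
have : (fun h : R => cross_quad_lin g A v w + h *: cross_quad g A w) @ 0^'
    --> cross_quad_lin g A v w + (0 : R) *: cross_quad g A w.
  apply: cvgD; first exact: cvg_cst.
  by apply: cvgZr_tmp; exact: cvg_within.
rewrite scale0r addr0; apply: cvg_trans; apply: near_eq_cvg.
near=> h; have h0 : h != 0 by near: h; exact: nbhs_dnbhs_neq.
by rewrite /= cross_quadDZ addrAC subrr add0r scalerA mulVf// scale1r.
Unshelve. all: by end_near. Qed.

Lemma jacobian_cross_quad (g : R) (A : 'M[R]_3) v w :
  jacobian_mx (cross_quad g A) v *m w = cross_quad_lin g A v w.
Proof.
have -> : jacobian_mx (cross_quad g A) v =
    \matrix_(i, j) cross_quad_lin g A v (delta_mx j 0) i 0.
  by apply/matrixP => i j; rewrite mxE derive_cross_quad [RHS]mxE.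
by apply: cV3P; rewrite /cross_quad_lin !(crossE, mxE, sum3) /=; ring.
Qed.

(** The Jacobian of a quadratic map is affine along a segment, so its mean there is its value at the
    midpoint. *)
Lemma cross_quadB (g : R) (A : 'M[R]_3) v w :
  cross_quad g A (w + v) - cross_quad g A v =
  jacobian_mx (cross_quad g A) (v + 2^-1 *: w) *m w.
Proof.
rewrite jacobian_cross_quad /cross_quad_lin /cross_quad !mulmxDr -!scalemxAr.
by apply: cV3P; rewrite !(crossE, mxE); field.
Qed.

Lemma dot_midpt_le (u v : 'cV[R]_3) :
  let m := 2^-1 *: (u + v) in
  dot m m <= 2^-1 * (dot u u + dot v v).
Proof.
rewrite /= !dotE !mxE.
have h (a b : R) : 2^-1 * (a + b) * (2^-1 * (a + b)) <= 2^-1 * (a * a + b * b).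
  rewrite -subr_ge0 (_ : _ - _ = (2^-1 * (a - b)) ^+ 2) ?sqr_ge0//.
  by field.
have := h (u 0 0) (v 0 0); have := h (u 1 0) (v 1 0); have := h (u 2 0) (v 2 0).
lra.
Qed.

(** Energy estimate from [|e1|^2 - |e0|^2 = 2 <e1 - e0, em>]. Here [d] is the flux defect, which
    enters the scheme both directly and through the cross product with [Mm]. The implicit part of
    the midpoint error stays on the left, in the form that [gronwall] consumes. *)
Lemma error_step (g c1 C1 dt eta k : R) (A : 'M[R]_3) (e0 e1 Mm mm d : 'cV[R]_3) :
  0 < g -> 0 <= dt -> 0 <= c1 ->
  (forall v, dot (A *m v) v = 0) ->
  let em := 2^-1 *: (e0 + e1) in
  Mm = em + mm ->
  e1 - e0 = dt *: (- (A *m em) + (cross_quad g A Mm - cross_quad g A mm)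
                   + (d + g *: cross Mm d)) ->
  enorm Mm <= C1 -> enorm d <= eta ->
  dot (jacobian_mx (cross_quad g A) (mm + 2^-1 *: em) *m em) em
    <= g * c1 * enorm em ^+ 2 ->
  1 + 2 * c1 * g + 2 * C1 * g = k ->
  dot e1 e1 * (1 - k * dt / 2) <=
  dot e0 e0 * (1 + k * dt / 2) + dt * ((1 + g * C1) * eta ^+ 2).
Proof.
move=> g0 dt0 c10 skA em Mem e1e0 MC1 dle jac kE.
have C10 : 0 <= C1 by apply: le_trans MC1; exact: enorm_ge0.
have eta0 : 0 <= eta by apply: le_trans dle; exact: enorm_ge0.
have energy : dot e1 e1 - dot e0 e0 = 2 * dot (e1 - e0) em.
  by rewrite !dotE !mxE; field.
have em0 := enorm_ge0 em.
have dd : dot d em <= eta * enorm em.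
  by apply: le_trans (dot_le _ _) _; rewrite ler_wpM2r.
have cd : dot (cross Mm d) em <= C1 * eta * enorm em.
  apply: le_trans (dot_le _ _) _; rewrite ler_wpM2r//.
  apply: le_trans (enorm_cross _ _) _.
  by rewrite ler_pM ?enorm_ge0.
have expand : dot (e1 - e0) em = dt * (- dot (A *m em) em
   + dot (jacobian_mx (cross_quad g A) (mm + 2^-1 *: em) *m em) em
   + (dot d em + g * dot (cross Mm d) em)).
  rewrite e1e0 {1}Mem cross_quadB.
  set J := _ *m _; set u := cross _ _.
  by rewrite !dotE !mxE; ring.
(* Young's inequality splits the defect terms into a source [(1 + g * C1) * eta ^+ 2] and a multiple
   of [enorm em ^+ 2]. With the Jacobian term, the total coefficient of [enorm em ^+ 2] is
   [1 + 2 * c1 * g + C1 * g], at most [k]. *)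
have amgm : 2 * (eta * enorm em) <= eta ^+ 2 + enorm em ^+ 2.
  by rewrite -subr_ge0 (_ : _ - _ = (eta - enorm em) ^+ 2) ?sqr_ge0//; ring.
have mid : enorm em ^+ 2 <= 2^-1 * (dot e0 e0 + dot e1 e1).
  by rewrite enorm_sqr; exact: dot_midpt_le.
have key : dot e1 e1 - dot e0 e0 <=
    dt * (k * enorm em ^+ 2 + (1 + g * C1) * eta ^+ 2).
  rewrite energy expand skA oppr0 add0r mulrCA ler_wpM2l//.
  have gC : 0 <= g * C1 by rewrite mulr_ge0// ltW.
  have h1 : g * dot (cross Mm d) em <= g * C1 * (eta * enorm em).
    by rewrite -mulrA ler_wpM2l ?(ltW g0)// mulrA.
  have h2 : (1 + g * C1) * (2 * (eta * enorm em)) <=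
            (1 + g * C1) * (eta ^+ 2 + enorm em ^+ 2).
    by rewrite ler_wpM2l// addr_ge0.
  have h3 : 0 <= g * C1 * enorm em ^+ 2 by rewrite mulr_ge0// sqr_ge0.
  rewrite -kE; move: jac dd h1 h2 h3.
  set X := dot _ em; set Y := dot _ em; set Z := g * dot _ em.
  set E := eta * _; set E2 := enorm em ^+ 2; set t2 := eta ^+ 2.
  move=> *; nra.
have k0 : 0 <= k.
  by rewrite -kE !addr_ge0// !mulr_ge0// ltW.
have h4 : dt * k * enorm em ^+ 2 <= dt * k * (2^-1 * (dot e0 e0 + dot e1 e1)).
  by rewrite ler_wpM2l// mulr_ge0.
move: key h4; set E2 := enorm em ^+ 2; set B := (1 + _) * _.
set a := dot e0 e0; set b := dot e1 e1 => key h4.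
rewrite mulrDr in key.
have : b - a <= dt * k * (2^-1 * (a + b)) + dt * B.
  by apply: le_trans key _; rewrite lerD2r mulrA.
rewrite (_ : dt * k * (2^-1 * (a + b)) = (k * dt / 2) * a + (k * dt / 2) * b).
    by rewrite mulrBr mulrDr !mulr1 [a * _]mulrC [b * _]mulrC; lra.
by field.
Qed.

(** With [x = k * dt / 2 <= 1 / 3], division by [1 - x] multiplies the old term by at most
    [1 + 3 * x] and the source by at most [3 / 2]. Over [N] steps the exponent [3 * x * N] becomes
    [3 * k / 2] times the elapsed time. *)
Lemma gronwall (k dt B : R) (a : nat -> R) (N : nat) :
  0 < k -> 0 <= dt -> k * dt <= 2 / 3 -> 0 <= B -> a 0%N = 0 ->
  (forall n, 0 <= a n) ->
  (forall n, (n < N)%N ->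
     a n.+1 * (1 - k * dt / 2) <= a n * (1 + k * dt / 2) + dt * B) ->
  a N <= expR (3 * k / 2 * (N%:R * dt)) * (N%:R * dt) * (3 / 2 * B).
Proof.
move=> k0 dt0 kdt B0 a0 age0 rec.
set x := k * dt / 2 in rec *.
have x0 : 0 <= x by rewrite divr_ge0// mulr_ge0// ltW.
have x3 : x <= 1 / 3 by rewrite /x; lra.
have ex : 1 + 3 * x <= expR (3 * x) by exact: expR_ge1Dx.
have e1 : 1 <= expR (3 * x) by rewrite -expR0 ler_expR mulr_ge0.
have step n : (n < N)%N -> a n.+1 <= expR (3 * x) * (a n + dt * (3 / 2 * B)).
  move=> /rec h.
  have an := age0 n; have an1 := age0 n.+1.
  have dB : 0 <= dt * B by rewrite mulr_ge0.
  have h1 : a n.+1 <= a n * (1 + 3 * x) + dt * (3 / 2 * B).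
    have q : 0 < 1 - x by lra.
    rewrite -(ler_pM2r q); apply: le_trans h _.
    (* [(1 + 3x)(1 - x) - (1 + x) = x(1 - 3x)] and [3/2 (1 - x) - 1 = (1 - 3x)/2]; both are
       nonnegative for [x] in [[0, 1/3]]. *)
    have : 0 <= a n * (x * (1 - 3 * x)).
      by rewrite mulr_ge0// mulr_ge0//; lra.
    have : 0 <= dt * B * (1 - 3 * x) by rewrite mulr_ge0//; lra.
    rewrite [dt * (_ * B)]mulrCA; move: (dt * B) (a n) => D A; lra.
  apply: le_trans h1 _; rewrite [leRHS]mulrDr lerD//.
    by rewrite mulrC ler_wpM2r.
  by rewrite ler_peMl// mulr_ge0// mulr_ge0//; lra.
have : forall n, (n <= N)%N ->
    a n <= expR (3 * x) ^+ n * (n%:R * (dt * (3 / 2 * B))).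
  elim=> [|n IH] nN; first by rewrite a0 mul0r mulr0.
  apply: le_trans (step _ nN) _.
  rewrite exprS -[leRHS]mulrA ler_wpM2l ?expR_ge0//.
  have E (y : R) : n.+1%:R * y = y + n%:R * y by rewrite -natr1 mulrDl mul1r addrC.
  rewrite E [leRHS]mulrDr [leLHS]addrC lerD ?IH 1?ltnW//.
  by rewrite ler_peMl ?exprn_ege1// mulr_ge0// mulr_ge0//; lra.
move=> /(_ N (leqnn N)) /le_trans; apply.
rewrite -expRM_natl le_eqVlt; apply/orP; left; apply/eqP.
rewrite -!mulrA; congr (expR _ * _); rewrite /x; by field.
Qed.

End euclid.

(** * Weierstrass approximation *)

Section weierstrass.
Variable R : realType.

(* The expectation of f at a binomial variable of parameters n and x, as a
   polynomial in x; conditioning on the first trial gives the recursion. *)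
Fixpoint bernstein (n : nat) (f : nat -> R) : {poly R} :=
  if n is n'.+1 then
    'X * bernstein n' (f \o succn) + (1 - 'X) * bernstein n' f
  else (f 0%N)%:P.

Let horner_step (p q : {poly R}) x :
  ('X * p + (1 - 'X) * q).[x] = x * p.[x] + (1 - x) * q.[x].
Proof. by rewrite !hornerE. Qed.

Lemma bernstein_le n (f g : nat -> R) x : 0 <= x <= 1 ->
  (forall i, (i <= n)%N -> f i <= g i) ->
  (bernstein n f).[x] <= (bernstein n g).[x].
Proof.
move=> /andP[x0 x1]; elim: n f g => [|n IH] f g fg /=.
  by rewrite !hornerC fg.
rewrite !horner_step lerD// ler_wpM2l ?subr_ge0//.
  by apply: IH => i ?; exact: fg.
by apply: IH => i ?; apply: fg; rewrite leqW.
Qed.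

Lemma bernsteinD n (f g : nat -> R) (a : R) x :
  (bernstein n (fun i => f i + a * g i)).[x] =
  (bernstein n f).[x] + a * (bernstein n g).[x].
Proof.
elim: n f g => [|n IH] f g /=; first by rewrite !hornerC.
rewrite !horner_step (IH f g) -[X in bernstein n X]/(fun i => (f \o succn) i + a * (g \o succn) i).
by rewrite (IH (f \o succn)); ring.
Qed.

Lemma bernstein_cst n (c x : R) : (bernstein n (fun=> c)).[x] = c.
Proof.
elim: n => [|n IH] /=; first by rewrite hornerC.
by rewrite horner_step IH; ring.
Qed.

(** Second moment about an arbitrary [c]: conditioning on a success shifts [c] by 1, so the
    induction needs every [c]. At [c = - n x] only the binomial variance [n x (1 - x)] remains. *)
Lemma bernstein_sqr n (c x : R) :
  (bernstein n (fun i => (i%:R + c) ^+ 2)).[x] =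
  (n%:R * x + c) ^+ 2 + n%:R * (x * (1 - x)).
Proof.
elim: n c => [|n IH] c /=; first by rewrite hornerC; ring.
rewrite horner_step IH.
rewrite (_ : _ \o succn = (fun i => (i%:R + (c + 1)) ^+ 2)); last first.
  by apply/funext => i /=; rewrite -natr1 -addrA [1 + c]addrC.
by rewrite IH -natr1; ring.
Qed.

(** Uniform continuity gives [d] for points closer than some [e]; farther apart,
    [(x - y)^2 / e^2 >= 1] and the oscillation of [f] suffices. The quadratic form is what a
    variance can control. *)
Lemma continuous_segment_modulus (f : R -> R) (a b d : R) :
  {within `[a, b], continuous f} -> 0 < d ->
  exists2 M, 0 <= M & forall x y, x \in `[a, b] -> y \in `[a, b] ->
    `|f x - f y| <= d + M * (x - y) ^+ 2.
Proof.
move=> cf d0; have [ab|ba] := leP a b; last first.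
  exists 0 => // x y; rewrite in_itv/= => /andP[ax xb].
  by have := lt_le_trans ba (le_trans ax xb); rewrite ltxx.
have [u _ fu] := EVT_max ab cf; have [v vab fv] := EVT_min ab cf.
have K : compact `[a, b] by exact: segment_compact.
pose close e x := forall y, y \in `[a, b] -> `|x - y| < e -> `|f x - f y| <= d.
(* Uniform continuity, from compactness in its near-covering form. *)
have : \forall e \near 0^'+, `[a, b] `<=` close e.
  apply: (near_covering_withinP _).2 => // [|x xab].
    exact/compact_near_coveringP.
  move/subspace_continuousP : cf => /(_ x xab)/cvgr_dist_le.
  have d2 : 0 < d / 2 by rewrite divr_gt0.
  move=> /(_ _ d2); rewrite near_withinE => -[/= r r0 xr].
  have r2 : 0 < r / 2 by rewrite divr_gt0.
  near=> x' e => /= x'ab y yab x'y.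
  rewrite (splitr d) -(subrKA (f x)); apply: le_trans (ler_normD _ _) _.
  apply: lerD; first rewrite distrC.
    apply: xr => //=.
  apply: xr => //=.
  rewrite -(subrKA x'); apply: le_lt_trans (ler_normD _ _) _.
  rewrite (splitr r) ltrD//.
  by apply: lt_trans x'y _; near: e; apply: nbhs_right_lt; rewrite divr_gt0.
move=> H; near (0 : R)^'+ => e.
have e0 : 0 < e by [].
have He : `[a, b] `<=` close e by near: e.
exists ((f u - f v) / e ^+ 2).
  by rewrite divr_ge0 ?sqr_ge0// subr_ge0 fu//.
move=> x y xab yab; have [xy|xy] := ltP `|x - y| e.
  apply: (le_trans (He x xab y yab xy)); rewrite lerDl.
  by rewrite mulr_ge0 ?sqr_ge0// divr_ge0 ?sqr_ge0// subr_ge0 fu.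
apply: (@le_trans _ _ (f u - f v)).
  rewrite ler_norml opprB; have := fu x xab; have := fu y yab.
  by have := fv x xab; have := fv y yab; move=> *; apply/andP; split; lra.
rewrite -[leLHS]add0r lerD ?(ltW d0)// -mulrA ler_peMr ?subr_ge0 ?fu//.
rewrite mulrC ler_pdivlMr ?exprn_gt0// mul1r.
by rewrite -[leRHS]real_normK ?num_real// ler_sqr ?nnegrE ?normr_ge0// ltW.
Unshelve. all: by end_near. Qed.

Lemma weierstrass01 (f : R -> R) (d : R) :
  {within `[0, 1], continuous f} -> 0 < d ->
  exists P : {poly R}, forall x, x \in `[0, 1] -> `|P.[x] - f x| <= d.
Proof.
move=> cf d0.
have d20 : 0 < d / 2 by rewrite divr_gt0.
have [M M0 mod] := continuous_segment_modulus cf d20.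
(* [n > M / d], so the variance term [M / n * (x * (1 - x))] costs at most [d / 2], the other half
   being spent in the modulus. *)
pose n := (Num.truncn (M / d)).+1.
have n0 : 0 < n%:R :> R by rewrite ltr0n.
have nM : M / n%:R <= d.
  rewrite ler_pdivrMr// mulrC -ler_pdivrMr//; apply/ltW.
  by have := truncnS_gt (M / d).
exists (bernstein n (fun i => f (i%:R / n%:R))) => x x01.
have /andP[x0 x1] : 0 <= x <= 1 by move: x01; rewrite in_itv.
(* The signs [s = 1] and [s = -1] give the two sides of the absolute value. The modulus bounds
   [s * f (i / n)] at every node, and positivity of [bernstein] transfers the bound to [x]. *)
have bound (s : R) : `|s| = 1 ->
    s * ((bernstein n (fun i => f (i%:R / n%:R))).[x] - f x) <= d.
  move=> s1.
  have : (bernstein n (fun i => 0 + s * f (i%:R / n%:R))).[x] <=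
     (bernstein n (fun i => (s * f x + d / 2) + M / n%:R ^+ 2 * (i%:R + - (n%:R * x)) ^+ 2)).[x].
    apply: bernstein_le; first by rewrite x0.
    move=> i ni; rewrite add0r -addrA -lerBlDl -mulrBr.
    apply: le_trans (ler_norm _) _; rewrite normrM s1 mul1r.
    apply: le_trans (mod _ _ _ _) _ => //.
      rewrite in_itv/= divr_ge0//= ler_pdivrMr// mul1r ler_nat//.
    rewrite lerD2l le_eqVlt; apply/orP; left; apply/eqP.
    by field; rewrite lt0r_neq0.
  rewrite bernsteinD bernstein_cst add0r.
  rewrite bernsteinD bernstein_cst bernstein_sqr subrr expr0n/= add0r => h.
  rewrite mulrBr lerBlDr; apply: le_trans h _.
  rewrite addrC [s * _ + _]addrC addrA lerD2r.
  have : M / n%:R ^+ 2 * (n%:R * (x * (1 - x))) <= d / 2.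
    rewrite (_ : _ * _ = M / n%:R * (x * (1 - x))); last by field; rewrite lt0r_neq0.
    apply: (@le_trans _ _ (d * 2^-1)) => //; apply: ler_pM => //.
    - by rewrite divr_ge0// ltW.
    - by rewrite mulr_ge0// subr_ge0.
    - have : 0 <= (x - 2^-1) ^+ 2 by exact: sqr_ge0.
      by rewrite sqrrB; lra.
  lra.
have [h|h] := ger0P ((bernstein n (fun i => f (i%:R / n%:R))).[x] - f x).
  by have := bound 1; rewrite normr1 mul1r => /(_ erefl).
by have := bound (-1); rewrite normrN1 mulN1r => /(_ erefl).
Qed.

End weierstrass.

(** * Smooth functions and a cutoff *)

Section smooth.
Variable R : realType.
Implicit Types (f g : R -> R) (n : nat) (x y : R).

Definition smooth f := forall n x, derivable (derive1n n f) x 1.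

(** Finite-order differentiability, for inductions on the order: the derivative of a product or an
    inverse again involves products and inverses, at one order less. *)
Fixpoint diff_upto n f : Prop :=
  (forall x, derivable f x 1) /\ (if n is n'.+1 then diff_upto n' (derive1 f) else True).

Lemma smooth_diff_upto f : smooth f <-> forall n, diff_upto n f.
Proof.
split=> [sf n|df n].
  elim: n f sf => [|n IH] f sf /=; first by split => //; exact: (sf 0%N).
  split; first exact: (sf 0%N).
  by apply: IH => m x; rewrite -derive1Sn; exact: sf.
elim: n f df => [|n IH] f df; first by case: (df 0%N).
by rewrite derive1Sn; apply: IH => m; case: (df m.+1).
Qed.

Lemma diff_uptoW n f : diff_upto n.+1 f -> diff_upto n f.
Proof.
elim: n f => [|n IH] f [df]; first by case.
by move=> sf; split => //; exact: IH.
Qed.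

Lemma is_derive_derive1 f x : derivable f x 1 -> is_derive x 1 f (derive1 f x).
Proof. by move=> df; rewrite derive1E; exact: derivableP. Qed.

Lemma derive1_val f x d : is_derive x 1 f d -> derive1 f x = d.
Proof. by move=> df; rewrite derive1E derive_val. Qed.

Lemma smooth_primitive f g : (forall x, is_derive x 1 f (g x)) -> smooth g -> smooth f.
Proof.
move=> fg sg [|n] x; first by have [] := fg x.
by rewrite derive1Sn (_ : derive1 f = g)//; apply/funext => y; exact: derive1_val.
Qed.

Lemma smooth_derive1 f : smooth f -> smooth (derive1 f).
Proof. by move=> sf n x; rewrite -derive1Sn. Qed.

Lemma smooth_derivable f x : smooth f -> derivable f x 1.
Proof. by move=> /(_ 0%N). Qed.

Lemma derivable_continuous f x : derivable f x 1 -> {for x, continuous f}.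
Proof. by move=> /derivable1_diffP; exact: differentiable_continuous. Qed.

Lemma smooth_continuous f : smooth f -> continuous f.
Proof. by move=> sf x; exact/derivable_continuous/smooth_derivable. Qed.

Lemma smooth_derive1n n f : smooth f -> smooth (derive1n n f).
Proof.
elim: n f => [f sf|n IH f sf]; first exact: sf.
by rewrite derive1Sn; apply: IH; exact: smooth_derive1.
Qed.

Lemma diff_upto_cst n (c : R) : diff_upto n (fun=> c).
Proof.
elim: n c => [|n IH] c; (split; first by move=> x; exact: derivable_cst);
  first exact: I.
by rewrite (_ : derive1 _ = fun=> 0); [exact: IH|apply/funext => x; exact: derive1_cst].
Qed.

Lemma diff_uptoD n f g : diff_upto n f -> diff_upto n g ->
  diff_upto n (fun x => f x + g x).
Proof.
elim: n f g => [f g [df _] [dg _]|n IH f g [df sf] [dg sg]];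
  (split; first by move=> x; exact: derivableD); first exact: I.
rewrite (_ : derive1 _ = fun x => derive1 f x + derive1 g x); first exact: IH.
apply/funext => x; apply: derive1_val.
by apply: is_deriveD; exact: is_derive_derive1.
Qed.

Lemma diff_uptoM n f g : diff_upto n f -> diff_upto n g ->
  diff_upto n (fun x => f x * g x).
Proof.
elim: n f g => [|n IH] f g fn gn; move: (fn) (gn) => [df sf] [dg sg];
  (split; first by move=> x; exact: derivableM); first exact: I.
rewrite (_ : derive1 _ = fun x => f x * derive1 g x + g x * derive1 f x).
  apply: diff_uptoD; first exact: IH (diff_uptoW fn) sg.
  exact: IH (diff_uptoW gn) sf.
apply/funext => x; apply: derive1_val.
by apply: is_deriveM; exact: is_derive_derive1.
Qed.

Lemma diff_uptoV n f : (forall x, f x != 0) -> diff_upto n f ->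
  diff_upto n (fun x => (f x)^-1).
Proof.
move=> f0; elim: n => [|n IH] fn; move: (fn) => [df sf];
  (split; first by move=> x; exact: derivableV); first exact: I.
rewrite (_ : derive1 _ = fun x => ((-1) * ((f x)^-1 * (f x)^-1)) * derive1 f x).
  have fi := IH (diff_uptoW fn).
  have fii := diff_uptoM (diff_upto_cst n (-1)) (diff_uptoM fi fi).
  exact: diff_uptoM fii sf.
apply/funext => x; apply: derive1_val.
have h := @is_deriveV _ f x _ 1 (f0 x) (is_derive_derive1 (df x)).
rewrite (_ : _ * _ = - (f x) ^- 2 *: derive1 f x)//.
by rewrite mulN1r -expr2 exprVn.
Qed.

Lemma diff_upto_affine n f (a b : R) : diff_upto n f ->
  diff_upto n (fun x => f (a * x + b)).
Proof.
have da x : is_derive x 1 (fun x : R => a * x + b) a.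
  by apply: is_derive_eq; rewrite addr0 [_%:A]mulr1.
have dfa f' x : (forall y, derivable f' y 1) ->
    is_derive x 1 (fun x => f' (a * x + b)) (derive1 f' (a * x + b) * a).
  move=> df'.
  exact: (@is_derive1_comp _ f' _ x _ _ (is_derive_derive1 (df' _)) (da x)).
elim: n f => [f [df _]|n IH f [df sf]];
  (split; first by move=> x; have [] := dfa f x df); first exact: I.
rewrite (_ : derive1 _ = fun x => derive1 f (a * x + b) * a).
  exact: diff_uptoM (IH _ sf) (diff_upto_cst n a).
by apply/funext => x; apply: derive1_val; exact: dfa.
Qed.

Lemma smoothD f g : smooth f -> smooth g -> smooth (fun x => f x + g x).
Proof.
move=> /smooth_diff_upto sf /smooth_diff_upto sg; apply/smooth_diff_upto => n.
exact: diff_uptoD.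
Qed.

Lemma smoothM f g : smooth f -> smooth g -> smooth (fun x => f x * g x).
Proof.
move=> /smooth_diff_upto sf /smooth_diff_upto sg; apply/smooth_diff_upto => n.
exact: diff_uptoM.
Qed.

Lemma smoothV f : (forall x, f x != 0) -> smooth f -> smooth (fun x => (f x)^-1).
Proof.
move=> f0 /smooth_diff_upto sf; apply/smooth_diff_upto => n; exact: diff_uptoV.
Qed.

Lemma smooth_affine f (a b : R) : smooth f -> smooth (fun x => f (a * x + b)).
Proof.
move=> /smooth_diff_upto sf; apply/smooth_diff_upto => n; exact: diff_upto_affine.
Qed.

Lemma smooth_horner (p : {poly R}) : smooth (horner p).
Proof.
move=> n; elim: n p => [|n IH] p x; first exact: derivable_horner.
by rewrite derive1Sn -derivE; exact: IH.
Qed.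

Lemma smooth_cst (c : R) : smooth (fun=> c).
Proof. by apply/smooth_diff_upto => n; exact: diff_upto_cst. Qed.

(** Serves at the origin, where [flat_exp] is glued to 0 and differentiation rules do not apply. *)
Lemma is_derive_quadratic f x l C :
  (forall h, `|f (h + x) - f x - h * l| <= C * h ^+ 2) -> is_derive x 1 f l.
Proof.
move=> fC.
suff H : h^-1 *: (f (h *: 1 + x) - f x) @[h --> 0^'] --> l.
  by apply: DeriveDef; [apply/cvg_ex; exists l|exact: cvg_lim].
have C1 : 0 < `|C| + 1 by rewrite ltr_pwDr.
apply/cvgrPdist_le => e e0; near=> h.
have h0 : h != 0 by near: h; exact: nbhs_dnbhs_neq.
have he : `|h| <= e / (`|C| + 1).
  near: h; apply: dnbhs0_le; by rewrite divr_gt0.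
rewrite distrC [_ *: 1]mulr1.
rewrite (_ : h^-1 *: _ - l = h^-1 * (f (h + x) - f x - h * l)); last first.
  by rewrite mulrBr mulKf.
rewrite normrM normfV mulrC ler_pdivrMr ?normr_gt0//.
apply: le_trans (fC h) _; apply: (@le_trans _ _ (`|C| * `|h| ^+ 2)).
  by rewrite -[h ^+ 2]real_normK ?num_real// ler_wpM2r ?sqr_ge0// ler_norm.
rewrite expr2 mulrA ler_wpM2r//.
apply: (@le_trans _ _ ((`|C| + 1) * `|h|)); first by rewrite ler_wpM2r// lerDl.
by rewrite mulrC -ler_pdivlMr.
Unshelve. all: by end_near. Qed.

(* [p(1/x) exp(-1/x)] extended by 0: a family stable under differentiation. *)
Definition flat_exp (p : {poly R}) (x : R) : R :=
  if 0 < x then p.[x^-1] * expR (- x^-1) else 0.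

(** The inequality [y / n <= expR (y / n)] raised to the power [n]. *)
Lemma exprn_le_expR n y : 0 <= y -> y ^+ n <= n%:R ^+ n * expR y.
Proof.
move=> y0; have [->|n0] := posnP n.
  by rewrite !expr0 mul1r -expR0 ler_expR.
have nr : 0 < n%:R :> R by rewrite ltr0n.
have {1 2}-> : y = n%:R * (y / n%:R) by rewrite mulrCA divff ?mulr1 ?lt0r_neq0.
rewrite expRM_natl exprMn ler_wpM2l ?exprn_ge0 ?(ltW nr)//.
rewrite ler_pXn2r ?nnegrE ?divr_ge0 ?expR_ge0 ?(ltW nr)//.
by apply: le_trans (expR_ge1Dx _); rewrite lerDr.
Qed.

(** The extra factor [y ^+ n] closes the Horner induction: in [p * 'X + c] the leading part is [p]
    at exponent [n.+1]. *)
Lemma poly_le_expR (p : {poly R}) n :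
  exists2 C, 0 <= C & forall y, 0 <= y -> `|p.[y]| * y ^+ n <= C * expR y.
Proof.
elim/poly_ind: p n => [|p c IH] n.
  by exists 0 => // y _; rewrite horner0 normr0 !mul0r.
have [C C0 HC] := IH n.+1.
exists (C + `|c| * n%:R ^+ n) => [|y y0].
  by rewrite addr_ge0// mulr_ge0// exprn_ge0.
rewrite !hornerE; apply: (@le_trans _ _ ((`|p.[y]| * y + `|c|) * y ^+ n)).
  rewrite ler_wpM2r ?exprn_ge0//; apply: le_trans (ler_normD _ _) _.
  by rewrite normrM (ger0_norm y0).
rewrite !mulrDl -!mulrA -exprS lerD ?HC//.
by rewrite ler_wpM2l// exprn_le_expR.
Qed.

Lemma flat_exp_le (p : {poly R}) :
  exists C, forall x, `|flat_exp p x| <= C * x ^+ 2.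
Proof.
have [C C0 HC] := poly_le_expR p 2; exists C => x; rewrite /flat_exp.
case: ifPn => [x0|_]; last by rewrite normr0 mulr_ge0 ?sqr_ge0.
have xV : 0 <= x^-1 by rewrite invr_ge0 ltW.
rewrite normrM (ger0_norm (expR_ge0 _)) expRN ler_pdivrMr ?expR_gt0//.
have := HC _ xV; rewrite exprVn ler_pdivrMr ?exprn_gt0//.
by rewrite mulrAC.
Qed.

(** In the variable [y = 1/x], differentiation in [x] is [- y^2 d/dy], which sends [p(y) exp(-y)] to
    [y^2 (p - p')(y) exp(-y)]. At 0 the quadratic bound of [flat_exp_le] gives derivative 0. *)
Lemma is_derive_flat_exp (p : {poly R}) x :
  is_derive x 1 (flat_exp p) (flat_exp ('X^2 * (p - p^`())) x).
Proof.
have [x0|x0|->] := ltgtP x 0.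
- rewrite {2}/flat_exp ltNge (ltW x0)/=.
  apply: (@near_eq_is_derive _ _ _ (fun=> 0)).
  near=> y; apply/esym; rewrite /flat_exp ifF//; apply/negbTE; rewrite -leNgt ltW//.
  by near: y; exact: lt_nbhsl.
- rewrite {2}/flat_exp x0.
  have V : is_derive x 1 (fun y : R => y^-1) (- x ^- 2).
    have := @is_deriveV _ id x 1 1 (lt0r_neq0 x0) (is_derive_id _ _).
    by rewrite [_ *: _]mulr1.
  have E : is_derive x 1 (fun y => expR (- y^-1)) (x ^- 2 * expR (- x^-1)).
    have := @is_derive1_comp _ expR (fun y => - y^-1) x _ _ (is_derive_expR _) (is_deriveN V).
    by rewrite opprK mulrC.
  have P : is_derive x 1 (fun y => p.[y^-1]) (p^`().[x^-1] * - x ^- 2).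
    apply: (@is_derive1_comp _ (horner p) (fun y => y^-1) x _ _ _ V).
  apply: (@near_eq_is_derive _ _ _ (fun y => p.[y^-1] * expR (- y^-1))).
    near=> y; rewrite /flat_exp ifT//.
    by near: y; exact: lt_nbhsr.
  apply: is_derive_eq (is_deriveM P E) _.
  rewrite !hornerE /GRing.scale/= -exprVn; ring.
- rewrite {2}/flat_exp ltxx; have [C HC] := flat_exp_le p.
  apply: (@is_derive_quadratic _ _ _ C) => h.
  by rewrite mulr0 subr0 addr0 {2}/flat_exp ltxx subr0.
Unshelve. all: by end_near. Qed.

Lemma smooth_flat_exp (p : {poly R}) : smooth (flat_exp p).
Proof.
move=> n; elim: n p => [|n IH] p x; first by have [] := is_derive_flat_exp p x.
rewrite derive1Sn (_ : derive1 _ = flat_exp ('X^2 * (p - p^`())))//.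
by apply/funext => y; apply: derive1_val; exact: is_derive_flat_exp.
Qed.

Definition smooth_step (x : R) : R :=
  flat_exp 1 x / (flat_exp 1 x + flat_exp 1 (1 - x)).

Lemma flat_exp1_ge0 x : 0 <= flat_exp 1 x.
Proof. by rewrite /flat_exp; case: ifP => // _; rewrite hornerC mul1r expR_ge0. Qed.

Lemma flat_exp1_gt0 x : 0 < x -> 0 < flat_exp 1 x.
Proof. by move=> x0; rewrite /flat_exp x0 hornerC mul1r expR_gt0. Qed.

Let den_gt0 x : 0 < flat_exp 1 x + flat_exp 1 (1 - x).
Proof.
have [x0|x0] := ltP 0 x.
  by rewrite ltr_pwDl ?flat_exp1_gt0 ?flat_exp1_ge0.
by rewrite ltr_pwDr ?flat_exp1_ge0 ?flat_exp1_gt0//; lra.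
Qed.

Lemma smooth_smooth_step : smooth smooth_step.
Proof.
apply: smoothM; first exact: smooth_flat_exp.
apply: smoothV => [x|]; first by rewrite lt0r_neq0.
apply: smoothD; first exact: smooth_flat_exp.
rewrite (_ : (fun x => _) = (fun x => flat_exp 1 (-1 * x + 1))).
  exact/smooth_affine/smooth_flat_exp.
by apply/funext => x; rewrite mulN1r addrC.
Qed.

Lemma smooth_step_ge0 x : 0 <= smooth_step x.
Proof. by rewrite divr_ge0 ?flat_exp1_ge0// ltW. Qed.

Lemma smooth_step_le1 x : smooth_step x <= 1.
Proof. by rewrite ler_pdivrMr// mul1r lerDl flat_exp1_ge0. Qed.

Lemma smooth_step0 x : x <= 0 -> smooth_step x = 0.
Proof. by move=> x0; rewrite /smooth_step {1}/flat_exp ltNge x0 mul0r. Qed.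

Lemma smooth_step1 x : 1 <= x -> smooth_step x = 1.
Proof.
move=> x1; rewrite /smooth_step [X in _ + X]/flat_exp ifF ?addr0.
  by rewrite divff// lt0r_neq0// flat_exp1_gt0//; lra.
by apply/negbTE; rewrite -leNgt subr_le0.
Qed.

(** Equal to 1 on [[-1, 1]], a neighbourhood of the kernel support, and to 0 where [|x| >= 2]. *)
Definition cutoff (x : R) : R := smooth_step (2 - x) * smooth_step (2 + x).

Lemma smooth_cutoff : smooth cutoff.
Proof.
have s a : smooth (fun x => smooth_step (2 + a * x)).
  rewrite (_ : (fun x => _) = (fun x => smooth_step (a * x + 2))).
    exact/smooth_affine/smooth_smooth_step.
  by apply/funext => x; rewrite addrC.
have := smoothM (s (-1)) (s 1); congr (smooth _).
by apply/funext => x; rewrite mulN1r mul1r.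
Qed.

Lemma cutoff_ge0 x : 0 <= cutoff x.
Proof. by rewrite mulr_ge0 ?smooth_step_ge0. Qed.

Lemma cutoff_le1 x : cutoff x <= 1.
Proof. by rewrite mulr_ile1 ?smooth_step_ge0 ?smooth_step_le1. Qed.

Lemma cutoff1 x : `|x| <= 1 -> cutoff x = 1.
Proof.
by rewrite ler_norml => /andP[? ?]; rewrite /cutoff !smooth_step1 ?mulr1//; lra.
Qed.

Lemma cutoff0 x : 2 <= `|x| -> cutoff x = 0.
Proof.
rewrite /cutoff ler_normr => /orP[x2|x2].
  by rewrite smooth_step0 ?mul0r//; lra.
by rewrite [X in _ * X]smooth_step0 ?mulr0//; lra.
Qed.

End smooth.

(** * Iterated primitives *)

Section integrals.
Variable R : realType.
Notation mu := (@lebesgue_measure R).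
Implicit Types (f g h : R -> R) (D : set R) (a b c l x y z A B M d : R).

Lemma integrableM_bounded f h D M : measurable D ->
  mu.-integrable D (EFin \o f) -> measurable_fun D h ->
  (forall x, D x -> `|h x| <= M) ->
  mu.-integrable D (EFin \o (fun x => f x * h x)).
Proof.
move=> mD fi mh hM.
suff : mu.-integrable D ((EFin \o f) \* (EFin \o h))%E by [].
apply: integrableMl => //.
by exists M; split; [exact: num_real|move=> x Mx y Dy; apply: le_trans (ltW Mx); exact: hM].
Qed.

Lemma Rintegral_bounded f h D M : measurable D ->
  mu.-integrable D (EFin \o f) -> measurable_fun D h ->
  (forall x, D x -> `|h x| <= M) ->
  `|\int[mu]_(x in D) (f x * h x)| <= M * \int[mu]_(x in D) `|f x|.
Proof.
move=> mD fi mh hM; have fhi : mu.-integrable D (EFin \o (fun x => f x * h x)).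
  exact: integrableM_bounded hM.
apply: (@le_trans _ _ (\int[mu]_(x in D) `|f x * h x|)).
  exact: le_normr_Rintegral.
have nfi : mu.-integrable D (EFin \o (fun x => `|f x|)) by exact: integrable_norm.
rewrite -RintegralZl//; apply: le_Rintegral => //.
- exact: integrable_norm fhi.
- suff : mu.-integrable D (fun x => M%:E * (`|f x|)%:E)%E by [].
  exact: integrableZl.
- by move=> x Dx; rewrite normrM mulrC ler_wpM2r// hM.
Qed.

Lemma Rintegral_restrict f D : (forall x, ~ D x -> f x = 0) ->
  \int[mu]_x f x = \int[mu]_(x in D) f x.
Proof.
move=> f0; rewrite [RHS]Rintegral_mkcond; apply: eq_Rintegral => x _.
rewrite patchE; case: ifPn => [//|/negP xD].
by apply: f0 => Dx; apply: xD; rewrite inE.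
Qed.

Lemma integrable_restrict0 f D : measurable D -> (forall x, ~ D x -> f x = 0) ->
  mu.-integrable setT (EFin \o f) <-> mu.-integrable D (EFin \o f).
Proof.
move=> mD f0; rewrite [in X in _ <-> X]integrable_mkcond//.
rewrite (_ : (EFin \o f) \_ D = EFin \o f)//; apply/funext => x.
by rewrite patchE; case: ifPn => // /negP xD /=; rewrite f0// => Dx;
  apply: xD; rewrite inE.
Qed.

Lemma continuous_itv_bounded h a b : {within `[a, b], continuous h} ->
  exists M, forall x, x \in `[a, b] -> `|h x| <= M.
Proof.
move=> ch; have [ab|ba] := leP a b; last first.
  exists 0 => x; rewrite in_itv/= => /andP[ax xb].
  by have := lt_le_trans ba (le_trans ax xb); rewrite ltxx.
have [u _ hu] := EVT_max ab ch; have [v _ hv] := EVT_min ab ch.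
exists (`|h u| + `|h v|) => x xab; have := hu x xab; have := hv x xab.
have := ler_norm (h u); have := ler_norm (- h v); rewrite normrN => *.
have := normr_ge0 (h u); have := normr_ge0 (h v) => *.
by rewrite ler_norml; apply/andP; split; lra.
Qed.

Lemma integrableM_supp f h a b : mu.-integrable setT (EFin \o f) ->
  {within `[a, b], continuous h} ->
  (forall x, ~ x \in `[a, b] -> f x * h x = 0) ->
  mu.-integrable setT (EFin \o (fun x => f x * h x)).
Proof.
move=> fi ch fh0; apply/(@integrable_restrict0 _ `[a, b]) => //.
have [M hM] := continuous_itv_bounded ch.
apply: (integrableM_bounded (M := M)) => //.
  by apply: integrableS fi.
exact: subspace_continuous_measurable_fun.
Qed.

Lemma is_derive_continuous f g : (forall x, is_derive x 1 f (g x)) -> continuous f.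
Proof. by move=> fg x; have [df _] := fg x; exact: derivable_continuous. Qed.

Lemma continuous_itv_integrable f a b :
  {within `[a, b], continuous f} -> mu.-integrable `[a, b] (EFin \o f).
Proof. by move=> cf; apply: continuous_compact_integrable => //; exact: segment_compact. Qed.

Lemma continuous_primitive f : continuous f ->
  exists F : R -> R, forall x, is_derive x 1 F (f x).
Proof.
move=> cf.
pose F x := if 0 <= x then \int[mu]_(t in `]0, x]) f t else - \int[mu]_(t in `]x, 0]) f t.
have fi a b : mu.-integrable `[a, b] (EFin \o f).
  by apply: continuous_itv_integrable; exact: continuous_subspaceT.
exists F => x.
(* [a] lies below both 0 and [x], so near [x] the signed integral [F] equals the integral from [a]
   up to a constant, and the fundamental theorem applies to the latter. *)
pose a := - (`|x| + 1).
have a0 : a < 0 by rewrite oppr_lt0 ltr_wpDl.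
have ax : a < x.
  by have := ler_norm (- x); rewrite normrN /a; lra.
pose G y := \int[mu]_(t in `[a, y]) f t + - \int[mu]_(t in `[a, 0]) f t.
apply: (@near_eq_is_derive _ _ _ G).
  near=> y.
  have ay : a < y by near: y; exact: lt_nbhsr.
  rewrite /G /F; case: ifPn => y0.
    by rewrite (@Rintegral_itvB _ f (BLeft a) (BRight y) 0)// bnd_simp// ltW.
  have y0' : y <= 0 by rewrite leNgt; apply/negP => /ltW; apply/negP.
  rewrite -(@Rintegral_itvB _ f (BLeft a) (BRight 0) y)// ?bnd_simp//.
    by rewrite opprB.
  exact: ltW.
have [] := @continuous_FTC1_closed _ f a x (x + 1) _ (fi _ _) ax (cf x).
  by rewrite ltrDl.
move=> dF FE; rewrite -[f x]addr0; apply: is_deriveD.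
by rewrite -FE derive1E; exact: derivableP.
Unshelve. all: by end_near. Qed.

Lemma Rintegral_FTC f F a b : a <= b -> continuous f ->
  (forall x, is_derive x 1 F (f x)) -> \int[mu]_(x in `[a, b]) f x = F b - F a.
Proof.
rewrite le_eqVlt => /predU1P[->|ab] cf dF.
  by rewrite set_itv1 Rintegral_set1 subrr.
rewrite /Rintegral (@continuous_FTC2 _ f F a b ab)//.
- exact: continuous_subspaceT.
- have cF := is_derive_continuous dF.
  split; first by move=> x _; have [] := dF x.
    by apply: cvg_at_right_filter; exact: cF.
  by apply: cvg_at_left_filter; exact: cF.
- by move=> x _; rewrite derive1E derive_val.
Qed.

Lemma is_derive_le F f a b M : (forall x, is_derive x 1 F (f x)) ->
  (forall x, `|f x| <= M) -> `|F b - F a| <= M * `|b - a|.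
Proof.
move=> dF fM; wlog ab : a b / a <= b.
  move=> H; have [/H//|/ltW ba] := leP a b.
  by rewrite distrC (distrC b a); exact: H.
have [|c _ ->] := @MVT_segment _ F f a b ab (fun x _ => dF x).
  by apply: continuous_subspaceT; exact: is_derive_continuous dF.
by rewrite normrM ler_wpM2r.
Qed.

Lemma periodicz f : (forall x, f (x + 1) = f x) -> forall (n : int) x, f (x + n%:~R) = f x.
Proof.
move=> fp; have fn (n : nat) x : f (x + n%:R) = f x.
  elim: n => [|n IH]; first by rewrite addr0.
  by rewrite -natr1 addrA fp.
by case=> n x; [exact: fn|rewrite NegzE mulrNz -(fn n.+1) subrK].
Qed.

Lemma periodic01 f : (forall x, f (x + 1) = f x) -> forall x,
  exists2 y, 0 <= y < 1 & f x = f y.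
Proof.
move=> fp x; exists (x - (Num.floor x)%:~R).
  by rewrite subr_ge0 ge_floor ltrBlDl -intrD1 lt_succ_floor.
by rewrite -mulrNz periodicz.
Qed.

(** A relation, not an operator: the constant of integration stays free at each stage, to be fixed
    later by a zero-mean condition. *)
Fixpoint iter_primitive (k : nat) (Phi f : R -> R) : Prop :=
  if k is k'.+1 then
    exists2 Psi, forall x, is_derive x 1 Phi (Psi x) & iter_primitive k' Psi f
  else Phi = f.

Lemma iter_primitiveS k Phi f g : iter_primitive k Phi f ->
  (forall x, is_derive x 1 f (g x)) -> iter_primitive k.+1 Phi g.
Proof.
elim: k Phi => [|k IH] Phi /= => [-> dg|[Psi dPsi Pf] dg]; first by exists g.
by exists Psi => //; exact: IH.
Qed.

Lemma iter_primitiveZ k Phi f c : iter_primitive k Phi f ->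
  iter_primitive k (fun x => c * Phi x) (fun x => c * f x).
Proof.
elim: k Phi => [|k IH] Phi /= => [->//|[Psi dPsi Pf]].
exists (fun x => c * Psi x); last exact: IH.
by move=> x; have h := dPsi x; apply: is_derive_eq.
Qed.

Lemma iter_primitive_affine k Phi f a l : iter_primitive k Phi f ->
  iter_primitive k (fun x => Phi (a + l * x)) (fun x => l ^+ k * f (a + l * x)).
Proof.
have da x : is_derive x 1 (fun x : R => a + l * x) l.
  by apply: is_derive_eq; rewrite /GRing.scale/=; ring.
elim: k Phi => [|k IH] Phi /= => [->|[Psi dPsi Pf]].
  by apply/funext => x; rewrite mul1r.
exists (fun x => l * Psi (a + l * x)) => [x|].
  by rewrite mulrC; exact: (is_derive1_comp (dPsi _) (da x)).
rewrite (_ : (fun x => l ^+ k.+1 * _) = fun x => l * (l ^+ k * f (a + l * x))).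
  exact/iter_primitiveZ/IH.
by apply/funext => x; rewrite exprS mulrA.
Qed.

(** Zero mean makes the primitive periodic: [F (x + 1) - F x] is constant and equals the integral of
    [f] over a period. Subtracting the mean of [F] restores the hypothesis, so the construction
    iterates. *)
Lemma periodic_primitive f B : continuous f -> (forall x, f (x + 1) = f x) ->
  (forall x, `|f x| <= B) -> \int[mu]_(x in `[0, 1]) f x = 0 ->
  exists Phi : R -> R, [/\ forall x, is_derive x 1 Phi (f x),
    forall x, Phi (x + 1) = Phi x, forall x, `|Phi x| <= 2 * B &
    \int[mu]_(x in `[0, 1]) Phi x = 0].
Proof.
move=> cf fp fB f0.
have [F dF] := continuous_primitive cf.
have cF := is_derive_continuous dF.
have [F2 dF2] := continuous_primitive cF.
have F10 : F 1 - F 0 = 0 by rewrite -(Rintegral_FTC _ cf dF).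
have Fp x : F (x + 1) = F x.
  have d0 y : is_derive y 1 (fun y => F (y + 1) - F y) 0.
    have dF1 : is_derive y 1 (fun y => F (y + 1)) (f (y + 1)).
      rewrite -[f _]mulr1; apply: (is_derive1_comp (dF _)).
      by apply: is_derive_eq; rewrite /GRing.scale/=; ring.
    by apply: is_derive_eq; rewrite fp subrr.
  by have := is_derive_0_is_cst x 0 d0; rewrite add0r F10 => /eqP; rewrite subr_eq0 => /eqP.
pose c := F2 1 - F2 0.
exists (fun x => F x - c); split.
- by move=> x; apply: is_derive_eq; rewrite subr0.
- by move=> x; rewrite Fp.
- move=> x; have Fxy y : `|F x - F y| <= B.
    have [x' /andP[x0 x1] ->] := periodic01 Fp x.
    have [y' /andP[y0 y1] ->] := periodic01 Fp y.
    apply: le_trans (is_derive_le y' x' dF fB) _.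
    have B0 : 0 <= B by apply: le_trans (fB 0).
    by rewrite ler_piMr// ler_norml; apply/andP; split; lra.
  (* The mean [c] is a value [F z], so [F x - c] is bounded by the oscillation of [F] over one
     period. *)
  have [||z _] := @MVT_segment _ F2 F 0 1 _ (fun x _ => dF2 x) => //.
    by apply: continuous_subspaceT; exact: is_derive_continuous dF2.
  rewrite subr0 mulr1 /c => ->; apply: le_trans (Fxy z) _.
  by rewrite ler_peMl ?ler1n//; apply: le_trans (fB 0).
- rewrite RintegralB//; last 2 first.
  + by apply: continuous_itv_integrable; exact: continuous_subspaceT.
  + by apply: continuous_itv_integrable => x; exact: cvg_cst.
  rewrite (Rintegral_FTC _ cF dF2)// Rintegral_cst//= lebesgue_measure_itv/= lte01.
  by rewrite oppr0 addr0 /= mulr1 subrr.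
Qed.

Lemma periodic_iter_primitive k f B : continuous f ->
  (forall x, f (x + 1) = f x) ->
  (forall x, `|f x| <= B) -> \int[mu]_(x in `[0, 1]) f x = 0 ->
  exists2 Phi : R -> R, iter_primitive k Phi f & forall x, `|Phi x| <= 2 ^+ k * B.
Proof.
elim: k f B => [|k IH] f B cf fp fB f0.
  by exists f => // x; rewrite mul1r.
have [Psi [dPsi Psip PsiB Psi0]] := periodic_primitive cf fp fB f0.
have [Phi PPhi PhiB] := IH _ _ (is_derive_continuous dPsi) Psip PsiB Psi0.
exists Phi; first exact: iter_primitiveS PPhi dPsi.
by move=> x; rewrite exprSr -mulrA.
Qed.

Lemma weierstrass_smooth f d : continuous f -> 0 < d ->
  exists2 P : R -> R, smooth P & forall x, `|x| <= 2 -> `|P x - f x| <= d.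
Proof.
move=> cf d0.
have cg : {within `[0, 1], continuous (fun y : R => f (4 * y - 2))}.
  apply: continuous_subspaceT => y; apply: continuous_comp; last exact: cf.
  apply: derivable_continuous.
  by apply: derivableB => //; exact: derivableM.
have [p Hp] := weierstrass01 cg d0.
exists (fun x => p.[4^-1 * x + 2^-1]).
  by apply: smooth_affine; exact: smooth_horner. 
move=> x; rewrite ler_norml => /andP[x1 x2].
have := Hp (4^-1 * x + 2^-1); rewrite (_ : 4 * _ - 2 = x); last by field.
by apply; rewrite in_itv/=; apply/andP; split; lra.
Qed.

(** Approximate [f] by a polynomial and integrate back [k] times, matching values at 0; each
    integration over [[-2, 2]] at most doubles the error. *)
Lemma iter_primitive_approx k Phi f d : iter_primitive k Phi f -> continuous f ->
  0 < d -> exists Q : R -> R, [/\ smooth Q,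
    forall x, `|x| <= 2 -> `|derive1n k Q x - f x| <= d &
    forall x, `|x| <= 2 -> `|Q x - Phi x| <= 2 ^+ k * d].
Proof.
move=> + cf d0; elim: k Phi => [|k IH] Phi => [->|[Psi dPsi /IH [P [sP Pf PPsi]]]].
  have [P sP Pf] := weierstrass_smooth cf d0.
  by exists P; split => // x x2; rewrite mul1r Pf.
have [Q0 dQ0] := continuous_primitive (smooth_continuous sP).
pose Q x := Q0 x + (Phi 0 - Q0 0).
have dQ x : is_derive x 1 Q (P x).
  by rewrite /Q; apply: is_derive_eq; rewrite addr0.
exists Q; split.
- exact: smooth_primitive dQ sP.
- move=> x x2; rewrite derive1Sn (_ : derive1 Q = P) ?Pf//.
  by apply/funext => y; exact: derive1_val.
- move=> x x2; pose D y := Q y - Phi y.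
  have D0 : D 0 = 0 by rewrite /D /Q addrCA subrr addr0 subrr.
  have dD y : is_derive y 1 D (P y - Psi y) by rewrite /D; exact: is_deriveB.
  have cD : continuous D by exact: is_derive_continuous dD.
  have [z zx DE] : exists2 z, `|z| <= 2 & D x = (P z - Psi z) * x.
    move: x2; rewrite ler_norml => /andP[x1 x2].
    have [x0|x0] := leP 0 x.
      have [|z] := @MVT_segment _ D (fun y => P y - Psi y) 0 x x0 (fun y _ => dD y).
        exact: continuous_subspaceT.
      rewrite in_itv/= => /andP[z0 zx]; rewrite D0 !subr0 => E; exists z => //.
      by rewrite ler_norml; apply/andP; split; lra.
    have [|z] := @MVT_segment _ D (fun y => P y - Psi y) x 0 (ltW x0) (fun y _ => dD y).
      exact: continuous_subspaceT.
    rewrite in_itv/= => /andP[z0 zx]; rewrite D0 !sub0r => E; exists z => //.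
      by rewrite ler_norml; apply/andP; split; lra.
    by rewrite -[LHS]opprK E mulrN opprK.
  rewrite -/(D x) DE normrM exprS mulrC -mulrA.
  by apply: ler_pM => //; exact: PPsi.
Qed.

End integrals.

(** * Oscillatory integrals against a kernel *)

Section kernel.
Variable R : realType.
Notation mu := (@lebesgue_measure R).
Implicit Types (f g h : R -> R) (n : nat) (a b x y A : R).

Lemma derive1n_near n f h x : (\near x, f x = h x) -> derive1n n f x = derive1n n h x.
Proof.
elim: n f h => [|n IH] f h fh; first exact: nbhs_singleton fh.
rewrite !derive1Sn; apply: IH.
near=> y; rewrite !derive1E; apply: near_eq_derive.
by near: y; exact: near_join fh.
Unshelve. all: by end_near. Qed.

Lemma test_function_supp f : smooth f -> (forall x, 2 < `|x| -> f x = 0) ->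
  test_function f.
Proof.
move=> sf f0; split => //.
apply: (@subclosed_compact _ _ (`[-2, 2] : set R) (@closed_closure _ _)).
  exact: segment_compact.
have /closure_id -> : closed (`[-2, 2] : set R) by exact: itv_closed.
apply: closure_subset => x /= fx; rewrite in_itv/= -ler_norml leNgt.
by apply: contra fx => /f0 ->.
Qed.

Lemma near_norm_gt x : 2 < `|x| -> \near x, 2 < `|x|.
Proof.
move=> x2; have /cvgr_gt : `|y| @[y --> x] --> `|x| by exact: norm_continuous.
exact.
Qed.

Lemma near_norm_lt x : `|x| < 1 -> \near x, `|x| < 1.
Proof.
move=> x2; have /cvgr_lt : `|y| @[y --> x] --> `|x| by exact: norm_continuous.
exact.
Qed.

(** Dividing [f] by [A] makes it a competitor in the supremum; the sign [s] produces the absolute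
    value. *)
Lemma total_variation_line_bound g f A : BV_line g -> 0 < A -> smooth f ->
  (forall x, 2 < `|x| -> f x = 0) -> (forall x, `|f x| <= A) ->
  `|\int[mu]_x (g x * derive1 f x)| <= fine (total_variation_line g) * A.
Proof.
move=> [gi gTV] A0 sf f0 fA.
have TV (s : R) : `|s| = 1 ->
    s * \int[mu]_x (g x * derive1 f x) <= fine (total_variation_line g) * A.
  move=> s1.
  pose phi x := (s / A) * f x.
  have dphi x : is_derive x 1 phi ((s / A) * derive1 f x).
    have h := is_derive_derive1 (@smooth_derivable _ _ x sf).
    by rewrite /phi; apply: is_derive_eq.
  have phiE : derive1 phi = fun x => (s / A) * derive1 f x.
    by apply/funext => x; exact: derive1_val.
  have ub : ((\int[mu]_x (g x * derive1 phi x))%:E <= total_variation_line g)%E.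
    apply: ereal_sup_ubound; exists phi => //; split.
    - have sphi : smooth phi.
        by apply: smoothM; [exact: smooth_cst|exact: sf].
      have [] // := test_function_supp sphi _.
      by move=> x /f0; rewrite /phi => ->; rewrite mulr0.
    - by move=> x; have [] := dphi x.
    - rewrite phiE; apply: smooth_continuous.
      by apply: smoothM; [exact: smooth_cst|exact: smooth_derive1 sf].
    - move=> x; rewrite /phi normrM normrM s1 mul1r normfV (gtr0_norm A0).
      by rewrite mulrC ler_pdivrMr// mul1r.
  (* The supremum lies above a real number and below [+oo], so [fine] returns its true value instead
     of the default 0. *)
  have fin : total_variation_line g \is a fin_num.
    by rewrite fin_numE -ltey gTV andbT gt_eqF//; apply: lt_le_trans ub; exact: ltNyr.
  move: ub; rewrite -(fineK fin) lee_fin phiE.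
  rewrite (_ : (fun x => _) = fun x => (s / A) * (g x * derive1 f x)); last first.
    by apply/funext => x; rewrite mulrCA.
  rewrite RintegralZl//; last first.
    apply: (@integrableM_supp _ g (derive1 f) (-2) 2) => //.
      exact/continuous_subspaceT/smooth_continuous/smooth_derive1.
    move=> x; rewrite in_itv/= -ler_norml => /negP; rewrite -ltNge => /near_norm_gt x2.
    have -> : derive1 f x = 0; last by rewrite mulr0.
    rewrite derive1E (@near_eq_derive _ _ _ _ (fun=> 0)) ?derive_cst//.
    by apply: filterS x2 => y; exact: f0.
  by rewrite mulrAC ler_pdivrMr.
have [_|_] := ger0P (\int[mu]_x (g x * derive1 f x)).
  by have := TV 1; rewrite normr1 mul1r; exact.
by have := TV (-1); rewrite normrN1 mulN1r; exact.
Qed.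

(** * Kernels whose weak derivative has bounded variation *)

Section weak.
Variables (K g : R -> R) (r : nat).
Hypothesis K0 : forall x, 2^-1 < `|x| -> K x = 0.
Hypothesis wd : is_weak_derivative r K g.
Hypothesis bv : BV_line g.

Let K_out x : ~ x \in `[- 2^-1, 2^-1] -> K x = 0.
Proof. by rewrite in_itv/= -ler_norml => /negP; rewrite -ltNge; exact: K0. Qed.

Lemma weak_kernel_integrable : mu.-integrable setT (EFin \o K).
Proof.
apply/(@integrable_restrict0 _ K `[- 2^-1, 2^-1]) => //.
have [[mK _ /(_ `[- 2^-1, 2^-1]%classic) iK] _ _] := wd.
apply/integrableP; split.
  by apply/measurable_EFinP; exact: measurable_funS mK.
by apply: iK => //; exact: segment_compact.
Qed.

(* Cutting off [f^(r+1)] before integrating by parts r times leaves the term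
   [cutoff' * f] against [g]; it vanishes because [cutoff'] is zero near the
   support of [K]. *)
Lemma weak_kernel_smooth f A : 0 < A -> smooth f ->
  (forall x, `|x| <= 2 -> `|f x| <= A) ->
  `|\int[mu]_x (K x * derive1n r.+1 f x)| <= fine (total_variation_line g) * A.
Proof.
move=> A0 sf fA; have [_ _ wdE] := wd.
have scut := @smooth_cutoff R.
have cut0 x : 2 < `|x| -> cutoff x = 0 by move=> /ltW; exact: cutoff0.
have dcut0 x : 2 < `|x| -> derive1 (@cutoff R) x = 0.
  move=> /near_norm_gt x2.
  rewrite derive1E (@near_eq_derive _ _ _ _ (fun=> 0)) ?derive_cst//.
  by apply: filterS x2 => y; exact: cut0.
have Kin x : K x != 0 -> \near x, `|x| < 1.
  move=> Kx; apply: near_norm_lt; apply: (@le_lt_trans _ _ 2^-1); last by lra.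
  by rewrite leNgt; apply: contra Kx => /K0 ->.
pose psi x : R := cutoff x * derive1 f x.
pose chi x : R := derive1 (@cutoff R) x * f x.
have spsi : smooth psi by apply: smoothM; [exact: scut|exact: smooth_derive1 sf].
have schi : smooth chi by apply: smoothM; [exact: smooth_derive1 scut|exact: sf].
have tpsi : test_function psi.
  by apply: test_function_supp => // x x2; rewrite /psi cut0 ?mul0r.
have tchi : test_function chi.
  by apply: test_function_supp => // x x2; rewrite /chi dcut0 ?mul0r.
(* Where [K] is nonzero the cutoff is identically 1 nearby, so [psi] and [f'] have the same
   derivatives there. *)
have Kpsi : \int[mu]_x (K x * derive1n r.+1 f x) = (-1) ^+ r * \int[mu]_x (g x * psi x).
  rewrite -(wdE _ tpsi); apply: eq_Rintegral => x _.
  have [->|/Kin x1] := eqVneq (K x) 0; first by rewrite !mul0r.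
  congr (_ * _); rewrite derive1Sn; apply: derive1n_near.
  by apply: filterS x1 => y /ltW y1; rewrite /psi cutoff1// mul1r.
have gchi : \int[mu]_x (g x * chi x) = 0.
  have := wdE _ tchi; rewrite (_ : (fun x => K x * _) = cst 0).
    rewrite Rintegral_cst// mul0r => /esym/eqP.
    by rewrite mulf_eq0 signr_eq0 => /eqP.
  apply/funext => x; have [->|/Kin x1] := eqVneq (K x) 0; first by rewrite !mul0r.
  rewrite (@derive1n_near r chi (fun=> 0) x).
    rewrite (_ : derive1n r _ = fun=> 0) ?mulr0//.
    elim: r => // n IH; rewrite derive1Sn (_ : derive1 _ = fun=> 0)//.
    by apply/funext => y; rewrite derive1_cst.
  near=> y; rewrite /chi derive1E (@near_eq_derive _ _ _ _ (fun=> (1 : R))).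
    by rewrite derive_cst mul0r.
  have : \near y, `|y| < 1 by near: y; exact: near_join x1.
  by apply: filterS => z /ltW; exact: cutoff1.
have dprod x : derive1 (fun y => cutoff y * f y) x = chi x + psi x.
  apply: derive1_val.
  have h1 := is_derive_derive1 (@smooth_derivable _ _ x scut).
  have h2 := is_derive_derive1 (@smooth_derivable _ _ x sf).
  by apply: is_derive_eq; rewrite addrC /chi /psi /GRing.scale/= [f x * _]mulrC.
have gint h : smooth h -> (forall x, 2 < `|x| -> h x = 0) ->
    mu.-integrable setT (EFin \o (fun x => g x * h x)).
  move=> sh h0; apply: (@integrableM_supp _ g h (-2) 2) => //.
  - by have [] := bv.
  - exact/continuous_subspaceT/smooth_continuous.
  - move=> x; rewrite in_itv/= -ler_norml => /negP; rewrite -ltNge => /h0 ->.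
    by rewrite mulr0.
have -> : \int[mu]_x (K x * derive1n r.+1 f x) =
    (-1) ^+ r * \int[mu]_x (g x * derive1 (fun y => cutoff y * f y) x).
  rewrite Kpsi; congr (_ * _).
  rewrite (_ : (fun x => g x * derive1 _ x) = fun x => g x * chi x + g x * psi x).
    rewrite RintegralD// ?gchi ?add0r//.
      by apply: gint => // x x2; rewrite /chi dcut0 ?mul0r.
    by apply: gint => // x x2; rewrite /psi cut0 ?mul0r.
  by apply/funext => x; rewrite dprod mulrDr.
rewrite normrM normrX normrN1 expr1n mul1r.
apply: total_variation_line_bound bv (A0) _ _ _.
  by apply: smoothM; [exact: scut|exact: sf].
  by move=> x x2; rewrite cut0 ?mul0r.
move=> x /=; have [x2|x2] := ltP 2 `|x|; first by rewrite cut0// mul0r normr0 ltW.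
by rewrite normrM ger0_norm ?cutoff_ge0// -[leRHS]mul1r ler_pM ?cutoff_ge0 ?cutoff_le1 ?fA.
Unshelve. all: by end_near. Qed.

(** The bound holds for a smooth [Q] close to [Phi] whose derivative of order [r.+1] is close to
    [f]. The error is linear in the accuracy [d], with a fixed factor, and [d] tends to 0. *)
Lemma weak_kernel_iter_primitive f Phi A : 0 <= A -> iter_primitive r.+1 Phi f ->
  continuous f -> (forall x, `|Phi x| <= A) ->
  `|\int[mu]_x (K x * f x)| <= fine (total_variation_line g) * A.
Proof.
move=> A0 PPhi cf PhiA.
set TV := fine _.
pose k1 := \int[mu]_x `|K x|.
pose c := 2 ^+ r.+1 : R.
have c0 : 0 < c by rewrite exprn_gt0.
have iKM h : continuous h -> mu.-integrable setT (EFin \o (fun x => K x * h x)).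
  move=> ch; apply: (@integrableM_supp _ K h (- 2^-1) 2^-1) => //.
  - exact: weak_kernel_integrable.
  - exact: continuous_subspaceT.
  - by move=> x /K_out ->; rewrite mul0r.
have key d : 0 < d -> `|\int[mu]_x (K x * f x)| <= TV * A + (TV * c + k1) * d.
  move=> d0; have [Q [sQ Qf QPhi]] := iter_primitive_approx PPhi cf d0.
  have cQ : continuous (derive1n r.+1 Q) by exact/smooth_continuous/smooth_derive1n.
  have -> : \int[mu]_x (K x * f x) = \int[mu]_x (K x * derive1n r.+1 Q x)
     - \int[mu]_x (K x * (derive1n r.+1 Q x - f x)).
    rewrite -RintegralB//; first last.
    - by apply: iKM => x; apply: continuousB; [exact: cQ|exact: cf].
    - exact: iKM.
    by apply: eq_Rintegral => x _; ring.
  apply: le_trans (ler_normB _ _) _.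
  rewrite mulrDl addrA -mulrA -mulrDr lerD//.
    apply: weak_kernel_smooth => //; first by rewrite ltr_wpDl// mulr_gt0.
    move=> x x2; rewrite -[Q x](subrK (Phi x)) addrC.
    by apply: le_trans (ler_normD _ _) _; rewrite lerD// QPhi.
  have restr h : \int[mu]_x (K x * h x) = \int[mu]_(x in `[- 2^-1, 2^-1]) (K x * h x).
    by apply: Rintegral_restrict => x /K_out ->; rewrite mul0r.
  have -> : k1 = \int[mu]_(x in `[- 2^-1, 2^-1]) `|K x|.
    by apply: Rintegral_restrict => x /K_out ->; rewrite normr0.
  rewrite restr mulrC; apply: Rintegral_bounded => //.
  - by apply: integrableS weak_kernel_integrable.
  - apply: measurable_funTS; apply: continuous_measurable_fun => x.
    by apply: continuousB; [exact: cQ|exact: cf].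
  - move=> x; rewrite /= in_itv/= -ler_norml => x1; apply: Qf; lra.
apply/ler_addgt0Pr => e e0.
have C0 : 0 < `|TV * c + k1| + 1 by rewrite ltr_wpDl.
have d0 : 0 < e / (`|TV * c + k1| + 1) by rewrite divr_gt0.
apply: le_trans (key _ d0) _; rewrite lerD2l.
rewrite mulrA ler_pdivrMr// mulrC ler_wpM2l// ?(ltW e0)//.
by apply: le_trans (ler_norm _) _; rewrite lerDl.
Qed.

(** Each primitive of [f (a + l * x)] gains a factor [1 / l], while periodic zero-mean primitives
    stay bounded. With [r = q + 1] and [l = tau / eps] this is the power [(eps / tau)^(q + 2)]. *)
Lemma weak_kernel_oscillation f a l B : 0 < l -> continuous f ->
  (forall x, f (x + 1) = f x) ->
  (forall x, `|f x| <= B) -> \int[mu]_(x in `[0, 1]) f x = 0 ->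
  `|\int[mu]_x (K x * f (a + l * x))| <=
    2 ^+ r.+1 * fine (total_variation_line g) * B * l ^- r.+1.
Proof.
move=> l0 cf fp fB f0.
have [Phi PPhi PhiB] := periodic_iter_primitive r.+1 cf fp fB f0.
have ln0 : l ^+ r.+1 != 0 by rewrite expf_neq0// lt0r_neq0.
have := iter_primitiveZ (l ^- r.+1) (iter_primitive_affine a l PPhi).
rewrite (_ : (fun x => l ^- r.+1 * (_ * _)) = fun x => f (a + l * x)); last first.
  by apply/funext => x; rewrite mulrA mulVf ?mul1r.
move=> /weak_kernel_iter_primitive => /(_ (l ^- r.+1 * (2 ^+ r.+1 * B))) H.
rewrite (_ : _ * _ = fine (total_variation_line g) * (l ^- r.+1 * (2 ^+ r.+1 * B))); last by ring.
have lp : 0 <= l ^- r.+1 by rewrite invr_ge0 exprn_ge0// ltW.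
apply: H.
- by rewrite !mulr_ge0//; apply: le_trans (fB 0).
- move=> x; apply: (@continuous_comp _ _ _ (fun x => a + l * x) f); last exact: cf.
  apply: derivable_continuous; apply: derivableD => //; exact: derivableM.
- move=> x; rewrite normrM (ger0_norm lp) ler_wpM2l//.
Qed.

End weak.
End kernel.

(** * Change of variables and one-sided derivatives *)

Section affine.
Variable R : realType.
Notation mu := (@lebesgue_measure R).
Variables (a t : R).
Hypothesis t0 : 0 < t.

Let phi : measurableTypeR R -> measurableTypeR R := fun s => (s - a) / t.

Let mphi : measurable_fun setT phi.
Proof.
apply: continuous_measurable_fun => x; apply: derivable_continuous.
by apply: derivableM => //; exact: derivableB.
Qed.

Let tV : 0 <= t^-1 := ltW (etrans (invr_gt0 t) t0).

Let image_mu : {measure set (measurableTypeR R) -> \bar R}.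
Proof.
refine (pushforward mu phi : {measure set (measurableTypeR R) -> \bar R}).
exact: mphi.
Defined.

Let nu : {measure set (measurableTypeR R) -> \bar R} := mscale (NngNum tV) image_mu.

Let phi_ocitv b c : phi @^-1` `]b, c]%classic = `]t * b + a, t * c + a]%classic.
Proof.
apply/seteqP; split => x /=; rewrite /phi !in_itv/= => /andP[h1 h2].
  move: h1 h2; rewrite ltr_pdivlMr// ler_pdivrMr// ltrBrDr lerBlDr.
  by rewrite ![_ * t]mulrC => -> ->.
rewrite ltr_pdivlMr// ler_pdivrMr// ltrBrDr lerBlDr.
by rewrite ![_ * t]mulrC h1 h2.
Qed.

(** Lebesgue measure is determined by half-open intervals, and [phi] pulls each one back to an
    interval [t] times as long. *)
Let muE A : measurable A -> mu A = nu A.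
Proof.
apply: lebesgue_measure_unique => //= _ [[b c]] _ <-.
rewrite -[RHS]/(t^-1%:E * mu (phi @^-1` `]b, c]))%E phi_ocitv !lebesgue_measure_itv/= !lte_fin.
rewrite ltrD2r ltr_pM2l//; case: ifPn => _; last by rewrite mule0.
rewrite -!EFinB -EFinM; congr (_%:E).
by rewrite opprD addrACA subrr addr0 -mulrBr mulKf// lt0r_neq0.
Qed.

Lemma ge0_integral_affine (F : R -> \bar R) : measurable_fun setT F ->
  (forall x, 0 <= F x)%E ->
  (\int[mu]_s F ((s - a) / t)%R = t%:E * \int[mu]_u F u)%E.
Proof.
move=> mF F0.
have -> : (\int[mu]_u F u = \int[nu]_u F u)%E.
  by apply: eq_measure_integral => A mA _; exact: muE.
rewrite /nu ge0_integral_mscale//= ge0_integral_pushforward//=.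
by rewrite preimage_setT muleA -EFinM divff ?mul1e ?lt0r_neq0.
Qed.

Lemma integrable_affine (f : R -> R) : mu.-integrable setT (EFin \o f) ->
  mu.-integrable setT (EFin \o (fun s => f ((s - a) / t))).
Proof.
move=> /integrableP[mf fi]; apply/integrableP; split.
  suff : measurable_fun setT ((EFin \o f) \o phi) by [].
  exact: measurableT_comp.
rewrite (@ge0_integral_affine (fun x => `|(f x)%:E|)%E)//.
  by rewrite lte_mul_pinfty// ?lee_fin ?(ltW t0).
exact: measurableT_comp.
Qed.

Lemma Rintegral_affine (f : R -> R) : mu.-integrable setT (EFin \o f) ->
  \int[mu]_s f ((s - a) / t) = t * \int[mu]_u f u.
Proof.
move=> fi; have /integrableP[mf _] := fi.
have pos : mu.-integrable setT (EFin \o f)^\+%E by exact: integrable_funepos.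
have neg : mu.-integrable setT (EFin \o f)^\-%E by exact: integrable_funeneg.
rewrite /Rintegral [X in fine X]integralE [X in _ * fine X]integralE.
have -> : (\int[mu]_s (fun s => (f ((s - a) / t))%:E)^\+ s = t%:E * \int[mu]_u (EFin \o f)^\+ u)%E.
  rewrite -ge0_integral_affine//; last by case/integrableP : pos.
  by apply: eq_integral => s _; rewrite !funeposE.
have -> : (\int[mu]_s (fun s => (f ((s - a) / t))%:E)^\- s = t%:E * \int[mu]_u (EFin \o f)^\- u)%E.
  rewrite -ge0_integral_affine//; last by case/integrableP : neg.
  by apply: eq_integral => s _; rewrite !funenegE.
have /fineK <- := integrable_fin_num measurableT pos.
have /fineK <- := integrable_fin_num measurableT neg.
by rewrite -!EFinM -!EFinB/= -mulrBr.
Qed.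

End affine.

(** * One-sided derivatives on a segment *)

Section one_sided.
Variable R : realType.

Lemma within_continuousD (A : set R) (f g : R -> R) :
  {within A, continuous f} -> {within A, continuous g} ->
  {within A, continuous (fun x => f x + g x)}.
Proof.
move=> cf cg x.
exact: (@continuousD _ _ _ (f : subspace A -> R) (g : subspace A -> R) x (cf x) (cg x)).
Qed.

Lemma within_continuousM (A : set R) (f g : R -> R) :
  {within A, continuous f} -> {within A, continuous g} ->
  {within A, continuous (fun x => f x * g x)}.
Proof.
move=> cf cg x.
exact: (@continuousM _ _ (f : subspace A -> R) (g : subspace A -> R) x (cf x) (cg x)).
Qed.

Lemma continuous_add (f g : R -> R) : continuous f -> continuous g ->
  continuous (fun x => f x + g x).
Proof. by move=> cf cg x; exact: (@continuousD _ _ _ f g x (cf x) (cg x)). Qed.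

Lemma continuous_mulr (f : R -> R) (c : R) : continuous f -> continuous (fun x => f x * c).
Proof.
move=> cf x; have cc : {for x, continuous (fun=> c)} by exact: cvg_cst.
exact: (@continuousM _ _ f (fun=> c) x (cf x) cc).
Qed.

Lemma within_continuous_cst (A : set R) (c : R) : {within A, continuous (fun=> c)}.
Proof. by move=> x; exact: cvg_cst. Qed.

Implicit Types (f : R -> R) (a b x l M : R).

Lemma is_derive_on_itv f a b x l : x \in `]a, b[ ->
  is_derive_on `[a, b] f x l -> is_derive x 1 f l.
Proof.
rewrite in_itv/= => /andP[ax xb] dfx.
suff H : h^-1 *: (f (h *: 1 + x) - f x) @[h --> 0^'] --> l.
  by apply: DeriveDef; [apply/cvg_ex; exists l|exact: cvg_lim].
apply/cvgrPdist_le => e e0.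
move/cvgrPdist_le : dfx => /(_ _ e0); rewrite near_withinE => -[/= r r0 rP].
near=> h; rewrite [_ *: 1]mulr1.
have h0 : h != 0 by near: h; exact: nbhs_dnbhs_neq.
have hr : `|h| < r by near: h; exact: dnbhs0_lt.
have hxa : `|h| < x - a by near: h; apply: dnbhs0_lt; rewrite subr_gt0.
have hxb : `|h| < b - x by near: h; apply: dnbhs0_lt; rewrite subr_gt0.
have := rP (h + x); rewrite /= addrK; apply => //=.
- by rewrite opprD addrCA subrr addr0 normrN.
- by rewrite -subr_eq0 addrK.
- move: hxa hxb; rewrite !ltr_norml in_itv/= => /andP[? ?] /andP[? ?].
  by apply/andP; split; lra.
Unshelve. all: by end_near. Qed.

Lemma is_derive_on_continuous f (df : R -> R) a b :
  {in `[a, b], forall x, is_derive_on `[a, b] f x (df x)} ->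
  {within `[a, b], continuous f}.
Proof.
move=> dfab; apply/subspace_continuousP => x xab.
have /cvgrPdist_le/(_ _ ltr01) := dfab x xab.
rewrite near_withinE => -[/= r r0 rP].
apply/cvgrPdist_le => e e0; rewrite near_withinE; near=> y => yab.
have [->|yx] := eqVneq y x; first by rewrite subrr normr0 ltW.
have c0 : 0 < `|df x| + 1 by rewrite ltr_pwDr.
have yr : `|x - y| < r.
  by near: y; exact: nbhsx_ballx.
have ye : `|x - y| < e / (`|df x| + 1).
  by near: y; apply: nbhsx_ballx; rewrite divr_gt0.
have := rP y yr yx yab.
have yx0 : y - x != 0 by rewrite subr_eq0.
set q := (y - x)^-1 *: _ => qd.
have fyx : f y - f x = (y - x) * q by rewrite /q mulrA divff// mul1r.
rewrite distrC fyx normrM distrC.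
have q1 : `|q| <= `|df x| + 1.
  rewrite -[q](subKr (df x)); apply: le_trans (ler_normB _ _) _.
  by rewrite lerD2l.
apply: (@le_trans _ _ (`|x - y| * (`|df x| + 1))); first by rewrite ler_wpM2l.
by rewrite -ler_pdivlMr// ltW.
Unshelve. all: by end_near. Qed.

Lemma itv_derive_le f (df : R -> R) a b M :
  {within `[a, b], continuous f} ->
  (forall x, x \in `]a, b[ -> is_derive x 1 f (df x)) ->
  (forall x, x \in `[a, b] -> `|df x| <= M) ->
  forall x y, x \in `[a, b] -> y \in `[a, b] -> `|f x - f y| <= M * `|x - y|.
Proof.
move=> cf dfab dfM x y xab yab.
wlog xy : x y xab yab / x <= y.
  move=> H; have [xy|/ltW yx] := leP x y; first exact: H.
  by rewrite distrC (distrC x y); exact: H.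
move: (xab) (yab); rewrite !in_itv/= => /andP[ax xb] /andP[ay yb].
have dfxy z : z \in `]x, y[ -> is_derive z 1 f (df z).
  rewrite in_itv/= => /andP[xz zy]; apply: dfab.
  by rewrite in_itv/= (le_lt_trans ax)// (lt_le_trans zy).
have [|z zxy E] := @MVT_segment _ f df x y xy dfxy.
- apply: continuous_subspaceW cf => z; rewrite /= !in_itv/= => /andP[xz zy].
  by rewrite (le_trans ax)// (le_trans zy).
- rewrite distrC E normrM (distrC y x) ler_wpM2r// dfM//.
  move: zxy; rewrite !in_itv/= => /andP[xz zy].
  by rewrite (le_trans ax)// (le_trans zy).
Qed.

Lemma is_derive_on_coord m n (f : R -> 'M[R]_(m, n)) (D : set R) x (l : 'M[R]_(m, n)) i j :
  is_derive_on D f x l -> is_derive_on D (fun y => f y i j) x (l i j).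
Proof.
move=> dfx; rewrite /is_derive_on.
have := @cvg_comp _ _ _ _ (fun A : 'M[R]_(m, n) => A i j) _ _ _ dfx (@coord_continuous _ _ _ i j l).
by apply: cvg_trans; apply: near_eq_cvg; near=> y; rewrite /= !mxE.
Unshelve. all: by end_near. Qed.

End one_sided.

(** * Continuity of a periodic field along a curve *)

Section periodic_field.
Variable R : realType.

Lemma continuous_glue_int (f : R -> R) :
  (forall n : int, {within `[n%:~R, n%:~R + 1], continuous f}) -> continuous f.
Proof.
move=> cf x; pose n := Num.floor x.
have nx : n%:~R <= x by exact: ge_floor.
have xn : x < n%:~R + 1 by rewrite -intrD1 lt_succ_floor.
(* Two adjacent unit cells, so that [x] is interior even when it is an integer. *)
have c2 : {within `[n%:~R - 1, n%:~R] `|` `[n%:~R, n%:~R + 1], continuous f}.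
  apply: withinU_continuous; [exact: itv_closed|exact: itv_closed| |exact: cf].
  by have := cf (n - 1); rewrite intrB subrK.
have c3 : {within `]n%:~R - 1, n%:~R + 1[, continuous f}.
  apply: continuous_subspaceW c2 => y; rewrite /= !in_itv/= => /andP[y1 y2].
  by have [yn|/ltW yn] := leP y n%:~R; [left|right]; rewrite ?(ltW y1) ?(ltW y2) ?yn.
move: c3; rewrite continuous_open_subspace; last exact: interval_open.
by apply; rewrite inE/= in_itv/= xn andbT; lra.
Qed.

Lemma within_continuous_pair (h : R -> R -> R) (u v : R -> R) (A B C : set R) :
  {within A `*` B, continuous (fun x : R * R => h x.1 x.2)} ->
  {within C, continuous u} -> {within C, continuous v} ->
  (forall x, C x -> A (u x) /\ B (v x)) ->
  {within C, continuous (fun x => h (u x) (v x))}.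
Proof.
move=> /subspace_continuousP ch /subspace_continuousP cu /subspace_continuousP cv CAB.
apply/subspace_continuousP => x Cx.
have [Au Bv] := CAB x Cx.
have hc := ch (u x, v x) (conj Au Bv).
apply: (@cvg_comp _ _ _ (fun x => (u x, v x)) (fun x => h x.1 x.2) _
  (within (A `*` B) (nbhs (u x, v x)))).
  have cuv : (fun y => (u y, v y)) @ within C (nbhs x) --> nbhs (u x, v x).
    exact: cvg_pair (cu x Cx) (cv x Cx).
  move=> P; rewrite /= nbhs_simpl => /cuv; rewrite /= !near_simpl !near_withinE.
  by apply: filterS => y Py Cy; apply: Py => //; exact: CAB.
exact: hc.
Qed.

(** On [[n, n + 1]] a translation by [n] moves the fast variable into [[0, 1]], where joint
    continuity is given; the cells are then glued. *)
Lemma continuous_periodic_field (h : R -> R -> R) (A : set R) (u : R -> R) :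
  {within A `*` `[0, 1], continuous (fun x : R * R => h x.1 x.2)} ->
  (forall t s, A t -> h t (s + 1) = h t s) ->
  continuous u -> (forall x, A (u x)) ->
  continuous (fun x => h (u x) x).
Proof.
move=> ch hp cu uA; apply: continuous_glue_int => n.
have -> : (fun x => h (u x) x) = (fun x => h (u x) (x - n%:~R)).
  apply/funext => x; have := @periodicz _ (h (u x)) _ (- n) x.
  by rewrite mulrNz => -> // s; exact: hp.
apply: within_continuous_pair ch _ _ _.
- exact: continuous_subspaceT.
- apply: continuous_subspaceT => x; apply: derivable_continuous; exact: derivableB.
- move=> x; rewrite /= !in_itv/= => /andP[nx xn]; split; first exact: uA.
  by rewrite subr_ge0 nx lerBlDr addrC.
Qed.

End periodic_field.

(** * The micro problem and the flux *)

Section linear_ode.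
Variable R : realType.

Lemma mulmx3E (A : 'M[R]_3) (v : 'cV[R]_3) i :
  (A *m v) i 0 = A i 0 * v 0 0 + A i 1 * v 1 0 + A i 2 * v 2 0.
Proof. by rewrite mxE sum3. Qed.

(** The squared norm has derivative [-2 <A m, m> = 0], so it is constant. The equation then bounds
    the velocity, and the mean value theorem the displacement. *)
Lemma skew_flow_bounds (a b t0 c : R) (A : R -> 'M[R]_3) (m dm : R -> 'cV[R]_3) :
  t0 \in `[a, b] ->
  {in `[a, b], forall t, is_derive_on `[a, b] m t (dm t)} ->
  {in `[a, b], forall t, dm t = - (A t *m m t)} ->
  {in `[a, b], forall t v, dot (A t *m v) v = 0} ->
  {in `[a, b], forall t v, enorm (A t *m v) <= c * enorm v} ->
  {in `[a, b], forall t, enorm (m t) = enorm (m t0) /\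
     forall i, `|dm t i 0| <= c * enorm (m t0) /\
       `|m t i 0 - m t0 i 0| <= c * enorm (m t0) * `|t - t0|}.
Proof.
move=> t0ab dmm dmE skA Ac.
have dmi i : {in `[a, b], forall t, is_derive_on `[a, b] (fun t => m t i 0) t (dm t i 0)}.
  by move=> t tab; apply: is_derive_on_coord; exact: dmm.
have cmi i := is_derive_on_continuous (dmi i).
have dmi' i t : t \in `]a, b[ -> is_derive t 1 (fun t => m t i 0) (dm t i 0).
  by move=> tab; apply: is_derive_on_itv (tab) _; apply: dmi; exact: subset_itv_oo_cc.
have norm_cst t : t \in `[a, b] -> enorm (m t) = enorm (m t0).
  move=> tab; rewrite /enorm; congr Num.sqrt.
  pose E t := m t 0 0 * m t 0 0 + m t 1 0 * m t 1 0 + m t 2 0 * m t 2 0.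
  suff : `|E t - E t0| <= 0 * `|t - t0|.
    by rewrite mul0r normr_le0 subr_eq0 !dotE => /eqP.
  apply: (@itv_derive_le _ E (fun=> 0) a b) => //; last by move=> x _; rewrite normr0.
    by apply: within_continuousD; [apply: within_continuousD|];
      apply: within_continuousM; exact: cmi.
  move=> x xab.
  have h0 := dmi' 0 x xab; have h1 := dmi' 1 x xab; have h2 := dmi' 2 x xab.
  rewrite /E; apply: is_derive_eq.
  have xab' : x \in `[a, b] by exact: subset_itv_oo_cc.
  have := skA x xab' (m x); have := dmE x xab'.
  move: (A x *m m x) => w ->; rewrite dotE !mxE /GRing.scale/= => sk.
  rewrite -[RHS](mulr0 (- 2)) -sk; ring.
move=> t tab; split; first exact: norm_cst.
have dm_le i x : x \in `[a, b] -> `|dm x i 0| <= c * enorm (m t0).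
  move=> xab; rewrite dmE// mxE normrN.
  by apply: le_trans (entry_le_enorm _ _) _; rewrite -(norm_cst x xab); exact: Ac.
move=> i; split; first exact: dm_le.
apply: (@itv_derive_le _ (fun t => m t i 0) (fun t => dm t i 0) a b) => //.
by move=> x; exact: dm_le.
Qed.

End linear_ode.

(** * Regularity, skewness and average of the field *)

Section field.
Variables (R : realType) (T c1 : R) (H : R -> R -> 'M[R]_3).
Notation mu := (@lebesgue_measure R).
Implicit Types (v : 'cV[R]_3) (i j : 'I_3) (t s : R).
Hypothesis T0 : 0 < T.
Hypothesis admH : admissible_field T c1 H.

Lemma admissible_field_ge0 : 0 <= c1.
Proof.
have [_ _ _ Hc _] := admH.
have T0' : 0 \in `[0, T] by rewrite in_itv/= lexx ltW.
pose v : 'cV[R]_3 := const_mx 1.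
have v0 : 0 < enorm v by rewrite sqrtr_gt0 dotE !mxE; lra.
have := le_trans (enorm_ge0 _) (Hc 0 T0' 0 v).
by rewrite pmulr_lge0.
Qed.

Lemma admissible_field_skew t s v : t \in `[0, T] -> dot (H t s *m v) v = 0.
Proof.
move=> tT; have [/(_ t tT s) [h1 [h2 [h3 ->]]] _ _ _ _] := admH.
by rewrite field_mxE dotE !crossE; ring.
Qed.

Lemma admissible_field_continuous (u : R -> R) i j : continuous u ->
  (forall x, u x \in `[0, T]) -> continuous (fun x => H (u x) x i j).
Proof.
have [_ Hp Hs _ _] := admH; move=> cu uT.
apply: (@continuous_periodic_field _ (fun t s => H t s i j) `[0, T] u) => //.
  have [D [D0 /(_ 0%N 0%N) [cD _]]] := Hs i j.
  apply: subspace_eq_continuous cD => -[t s]; rewrite inE/= => -[tT sT].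
  exact: D0.
by move=> t s tT; rewrite Hp.
Qed.

Lemma admissible_field_mul_continuous (u : R -> R) v i : continuous u ->
  (forall x, u x \in `[0, T]) -> continuous (fun x => (H (u x) x *m v) i 0).
Proof.
move=> cu uT.
rewrite (_ : (fun x => _) = (fun x => H (u x) x i 0 * v 0 0 + H (u x) x i 1 * v 1 0
   + H (u x) x i 2 * v 2 0)); last by apply/funext => x; exact: mulmx3E.
by apply: continuous_add; [apply: continuous_add|];
  apply: continuous_mulr; exact: admissible_field_continuous.
Qed.

Lemma admissible_field_lipschitz t t' s v i : t \in `[0, T] -> t' \in `[0, T] ->
  `|(H t s *m v) i 0 - (H t' s *m v) i 0| <= c1 * enorm v * `|t - t'|.
Proof.
have [_ _ _ _ [dtH dH]] := admH; move=> tT t'T.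
pose F x := H x s i 0 * v 0 0 + H x s i 1 * v 1 0 + H x s i 2 * v 2 0.
have dHj j : {in `[0, T], forall x, is_derive_on `[0, T] (fun x => H x s i j) x (dtH x s i j)}.
  by move=> x xT; apply: is_derive_on_coord; have [] := dH x xT s.
have cHj j := is_derive_on_continuous (dHj j).
rewrite !mulmx3E -/(F t) -/(F t').
apply: (@itv_derive_le _ F (fun x => (dtH x s *m v) i 0) 0 T) => //.
- by apply: within_continuousD; [apply: within_continuousD|];
    apply: within_continuousM; (try exact: within_continuous_cst); exact: cHj.
- move=> x xT; have xT' : x \in `[0, T] by exact: subset_itv_oo_cc.
  have h0 := is_derive_on_itv xT (dHj 0 x xT').
  have h1 := is_derive_on_itv xT (dHj 1 x xT').
  have h2 := is_derive_on_itv xT (dHj 2 x xT').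
  rewrite /F; apply: is_derive_eq; rewrite mulmx3E /GRing.scale/=; ring.
- move=> x xT; apply: le_trans (entry_le_enorm _ _) _.
  by have [] := dH x xT s.
Qed.

Let entry_integrable t i j : t \in `[0, T] ->
  mu.-integrable `[0, 1] (EFin \o (fun s => H t s i j)).
Proof.
move=> tT; apply: continuous_itv_integrable; apply: continuous_subspaceT.
by apply: (@admissible_field_continuous (fun=> t)) => //; exact: cst_continuous.
Qed.

Lemma avg_field_mul t v i : t \in `[0, T] ->
  (avg_field H t *m v) i 0 = \int[mu]_(s in `[0, 1]) (H t s *m v) i 0.
Proof.
move=> tT; rewrite mulmx3E !mxE.
have iv j : mu.-integrable `[0, 1] (EFin \o (fun s => H t s i j * v j 0)).
  apply: (integrableM_bounded (M := `|v j 0|)) => //.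
  exact: entry_integrable.
rewrite -!RintegralZr//; try exact: entry_integrable.
rewrite -!RintegralD//.
  by apply: eq_Rintegral => s _; rewrite mulmx3E.
rewrite (_ : EFin \o _ = (fun s => (H t s i 0 * v 0 0)%:E + (H t s i 1 * v 1 0)%:E)%E)//.
apply: integrableD => //; exact: iv.
Qed.

(** Antisymmetry passes through the integral entry by entry. *)
Lemma avg_field_skew t v : t \in `[0, T] -> dot (avg_field H t *m v) v = 0.
Proof.
move=> tT.
have anti i j : avg_field H t i j + avg_field H t j i = 0.
  rewrite !mxE -RintegralD//; try exact: entry_integrable.
  rewrite (_ : (fun s => _) = cst 0) ?Rintegral_cst ?mul0r//.
  apply/funext => s; have [/(_ t tT s) [h1 [h2 [h3 ->]]] _ _ _ _] := admH.
  by rewrite !mxE; case: i => -[|[|[|//]]] ?; case: j => -[|[|[|//]]] ? /=;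
    rewrite ?addr0 ?addrN ?addNr.
rewrite dotE !mulmx3E.
have a00 : avg_field H t 0 0 = 0 by have := anti 0 0; lra.
have a11 : avg_field H t 1 1 = 0 by have := anti 1 1; lra.
have a22 : avg_field H t 2 2 = 0 by have := anti 2 2; lra.
have a01 : avg_field H t 1 0 = - avg_field H t 0 1 by have := anti 0 1; lra.
have a02 : avg_field H t 2 0 = - avg_field H t 0 2 by have := anti 0 2; lra.
have a12 : avg_field H t 2 1 = - avg_field H t 1 2 by have := anti 1 2; lra.
by rewrite a00 a11 a22 a01 a02 a12; ring.
Qed.

End field.

(** * Consistency of the upscaled flux *)

Section flux.
Variable R : realType.
Notation mu := (@lebesgue_measure R).

Lemma scaled_kernel_integrable (K : R -> R) tau ta : 0 < tau ->
  mu.-integrable setT (EFin \o K) ->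
  mu.-integrable setT (EFin \o (fun s => scaled_kernel K tau (s - ta))).
Proof.
move=> tau0 iK; rewrite /scaled_kernel.
suff : mu.-integrable setT (fun s => (tau^-1)%:E * (K ((s - ta) / tau))%:E)%E by [].
by apply: integrableZl => //; exact: integrable_affine.
Qed.

Lemma Rintegral_scaled_kernel (K : R -> R) (tau ta : R) (h : R -> R) : 0 < tau ->
  mu.-integrable setT (EFin \o (fun u => K u * h (ta + tau * u))) ->
  \int[mu]_s (scaled_kernel K tau (s - ta) * h s) =
  \int[mu]_u (K u * h (ta + tau * u)).
Proof.
move=> tau0 iKh; have tau1 := lt0r_neq0 tau0.
have := Rintegral_affine ta tau0 iKh.
move=> /(congr1 ( *%R tau^-1)); rewrite mulKf// => <-.
rewrite -RintegralZl//; last exact: (integrable_affine ta tau0 iKh).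
apply: eq_Rintegral => s _; rewrite /scaled_kernel mulrA.
by congr (_ * h _); field.
Qed.

(** The constant is fixed before [T], [eps], [tau] and [H]: it involves only [c1], the order [q],
    the L1 norm of [K] and the total variation of its weak derivative. *)
Lemma flux_consistency (p : nat) (q : int) (K : R -> R) (c1 : R) :
  kernel_class p q K ->
  exists2 C0, 0 <= C0 & forall (T eps tau ta : R) (H : R -> R -> 'M[R]_3)
      (v f : 'cV[R]_3),
    0 < T -> admissible_field T c1 H -> 0 < eps -> 0 < tau ->
    0 <= ta - tau / 2 -> ta + tau / 2 <= T ->
    is_upscaled_flux H K eps tau ta v f ->
    enorm (f + avg_field H ta *m v) <=
      C0 * (tau + (eps / tau) ^ (q + 2)) * enorm v.
Proof.
move=> [q1 suppK _ [g wd bv] [K1 _]].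
have K0 x : 2^-1 < `|x| -> K x = 0.
  move=> x2; apply/eqP; apply: contraTT x2 => Kx; rewrite -leNgt ler_norml.
  by have := suppK x (@subset_closure R [set y | K y != 0] x Kx); rewrite /= in_itv.
set r := absz (q + 1) in wd.
have qE : q + 2 = r.+1%:Z.
  by rewrite intS /r gez0_abs; [ring|rewrite -lerBlDr sub0r].
have iK := weak_kernel_integrable K0 wd.
pose k1 : R := \int[mu]_x `|K x|.
have k10 : 0 <= k1 by apply: Rintegral_ge0.
pose TV : R := `|fine (total_variation_line g)|.
(* [A0] is the cost of freezing the micro solution and slow time, [D0] that of the oscillation.
   Absolute values appear because [0 <= c1] is known only once an admissible field is given. *)
pose A0 : R := (`|c1| * `|c1| + `|c1|) * k1.
pose D0 : R := 2 ^+ r.+1 * TV * (2 * `|c1|).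
have A00 : 0 <= A0 by rewrite mulr_ge0// addr_ge0// mulr_ge0.
have TV0 : 0 <= TV by exact: normr_ge0.
have D00 : 0 <= D0 by rewrite mulr_ge0// mulr_ge0.
exists (2 * (A0 + D0)) => [|T eps tau ta H v f T0 admH eps0 tau0 ta0 taT].
  by rewrite mulr_ge0// addr_ge0.
move=> [m [dm [mta dmm dmE fE]]].
set a := ta - tau / 2 in ta0 dmm dmE fE *; set b := ta + tau / 2 in taT dmm dmE fE *.
have c10 := admissible_field_ge0 T0 admH.
have abT s : s \in `[a, b] -> s \in `[0, T].
  by rewrite !in_itv/= => /andP[as_ sb]; rewrite (le_trans ta0)// (le_trans sb).
have taab : ta \in `[a, b] by rewrite in_itv/= /a /b; apply/andP; split; lra.
have taT' := abT _ taab.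
have dist s : s \in `[a, b] -> `|s - ta| <= tau / 2.
  by rewrite in_itv/= /a /b ler_norml => /andP[? ?]; apply/andP; split; lra.
have [_ Hp _ Hc _] := admH.
have flow := @skew_flow_bounds R a b ta c1 (fun t => H t (t / eps)) m dm taab dmm dmE
  (fun t tab v => admissible_field_skew admH (t / eps) v (abT t tab))
  (fun t tab v => Hc t (abT t tab) (t / eps) v).
rewrite mta in flow.
set V := enorm v in flow *.
have V0 : 0 <= V by exact: enorm_ge0.
pose w : R := (c1 * c1 + c1) * V * tau.
rewrite -mulrA -mulrA; apply: enorm_le_entries => i.
pose h (s : R) : R := (H ta s *m v) i 0.
pose hb : R := (avg_field H ta *m v) i 0.
have contdiv (F : R -> R) : continuous F -> continuous (fun s : R => F (s / eps)).
  move=> cF s; apply: (@continuous_comp _ _ _ (fun s : R => s / eps) F); last exact: cF.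
  by apply: derivable_continuous; exact: derivableM.
have ch : continuous h.
  by apply: (admissible_field_mul_continuous admH (u := fun=> ta)) => //; exact: cst_continuous.
have hle s : `|h s| <= c1 * V.
  by apply: le_trans (entry_le_enorm _ _) _; exact: Hc.
(* The gap between the true micro velocity and the one with solution and slow time frozen at
   [ta]. *)
pose W (s : R) : R := dm s i 0 + h (s / eps).
have W_le s : s \in `[a, b] -> `|W s| <= w.
  move=> sab; have [_ /(_ _) dmi] := flow s sab.
  rewrite /W /h dmE// mxE.
  set A := H s (s / eps); set B := H ta (s / eps).
  (* First the drift of the solution away from [v], then the drift of the slow time away from [ta];
     both are of order [tau]. *)
  rewrite (_ : _ + _ = - ((A *m (m s - v)) i 0) - ((A *m v) i 0 - (B *m v) i 0)); last first.
    by rewrite mulmxBr [X in _ = - X - _]mxE [X in _ = - (_ + X) - _]mxE; ring.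
  apply: le_trans (ler_normB _ _) _; rewrite normrN.
  have d2 := dist s sab.
  have e1 : enorm (m s - v) <= 2 * (c1 * V * (tau / 2)).
    apply: enorm_le_entries => j; rewrite !mxE.
    by have [_ h2] := dmi j; apply: le_trans h2 _; rewrite ler_wpM2l// mulr_ge0.
  have e2 : `|(A *m (m s - v)) i 0| <= c1 * (2 * (c1 * V * (tau / 2))).
    apply: le_trans (entry_le_enorm _ _) _; apply: le_trans (Hc _ (abT _ sab) _ _) _.
    by rewrite ler_wpM2l.
  have e3 := admissible_field_lipschitz admH (s / eps) v i (abT _ sab) taT'.
  have e4 : c1 * V * `|s - ta| <= c1 * V * tau.
    by rewrite ler_wpM2l ?mulr_ge0//; apply: le_trans d2 _; lra.
  apply: le_trans (lerD e2 (le_trans e3 e4)) _.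
  rewrite /w le_eqVlt; apply/orP; left; apply/eqP; by field.
have mdm : measurable_fun `[a, b] (fun s => dm s i 0).
  (* Clamping time to [0, T] makes the field globally continuous along the
     trajectory (t, t/eps), without changing it on [a, b]. *)
  pose cl (x : R) : R := Num.max 0 (Num.min T x).
  have ccl : continuous cl.
    move=> x; apply: (@continuous_max _ _ (fun=> 0) (fun x => Num.min T x)); first exact: cvg_cst.
    by apply: (@continuous_min _ _ (fun=> T) id); [exact: cvg_cst|exact: cvg_id].
  have clT x : cl x \in `[0, T].
    by rewrite in_itv/= /cl le_max lexx/= ge_max (ltW T0) ge_min lexx.
  have clE x : x \in `[0, T] -> cl x = x.
    by rewrite in_itv/= /cl => /andP[x0 xT]; rewrite min_r// max_r.
  have cHij j : continuous (fun s : R => H (cl s) (s / eps) i j).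
    have cu : continuous (fun x : R => cl (eps * x)).
      move=> x; apply: (@continuous_comp _ _ _ (fun x : R => eps * x) cl); last exact: ccl.
      by apply: derivable_continuous; exact: derivableM.
    (* The trajectory is parametrised by fast time [u = s / eps], as the continuity lemma requires;
       slow time is then [eps * u]. *)
    rewrite (_ : (fun s : R => _) = (fun s => H (cl (eps * (s / eps))) (s / eps) i j)).
      apply: (contdiv (fun u => H (cl (eps * u)) u i j)).
      by apply: (@admissible_field_continuous _ _ _ _ admH (fun u => cl (eps * u))).
    by apply/funext => x; rewrite [eps * _]mulrC divfK// lt0r_neq0.
  have cm j : {within `[a, b], continuous (fun s : R => m s j 0)}.
    apply: (@is_derive_on_continuous _ _ (fun s => dm s j 0)) => s sab.
    by apply: is_derive_on_coord; exact: dmm.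
  apply: subspace_continuous_measurable_fun => //.
  apply: (@subspace_eq_continuous _ _ _ (fun s : R => -1 * (H (cl s) (s / eps) i 0 * m s 0 0
     + H (cl s) (s / eps) i 1 * m s 1 0 + H (cl s) (s / eps) i 2 * m s 2 0))).
    move=> s; rewrite inE/= => sab; rewrite dmE// [RHS]mxE mulmx3E clE ?abT//; ring.
  apply: within_continuousM; first exact: within_continuous_cst.
  by apply: within_continuousD; [apply: within_continuousD|];
    apply: within_continuousM; (try exact: cm); exact: continuous_subspaceT.
(* The periodic fluctuation about the average, of mean zero. *)
pose G (s : R) : R := h s - hb.
have cG : continuous G.
  by apply: continuous_add => // s; exact: cvg_cst.
have hbE : hb = \int[mu]_(s in `[0, 1]) h s by exact: (avg_field_mul admH).
have ih : mu.-integrable `[0, 1] (EFin \o h).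
  by apply: continuous_itv_integrable; exact: continuous_subspaceT.
have hb_le : `|hb| <= c1 * V.
  have [F dF] := continuous_primitive ch.
  rewrite hbE (Rintegral_FTC _ ch dF)//; apply: le_trans (is_derive_le 0 1 dF hle) _.
  by rewrite subr0 normr1 mulr1.
have G_le s : `|G s| <= 2 * c1 * V.
  by rewrite mulrDl mul1r mulrDl; apply: le_trans (ler_normB _ _) _; rewrite lerD.
have G0 : \int[mu]_(s in `[0, 1]) G s = 0.
  rewrite RintegralB//; last by apply: continuous_itv_integrable; exact: within_continuous_cst.
  rewrite -hbE Rintegral_cst//= lebesgue_measure_itv/= lte01.
  by rewrite oppr0 addr0 /= mulr1 subrr.
have Gp s : G (s + 1) = G s by rewrite /G /h Hp.
pose Kt (s : R) : R := scaled_kernel K tau (s - ta).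
have iKt : mu.-integrable setT (EFin \o Kt) by exact: scaled_kernel_integrable.
have iKtI : mu.-integrable `[a, b] (EFin \o Kt) by apply: integrableS iKt.
have Kt0 s : ~ (s \in `[a, b]) -> Kt s = 0.
  rewrite in_itv/= /a /b => /negP sab; rewrite /Kt /scaled_kernel K0 ?mulr0//.
  rewrite normrM normfV (gtr0_norm tau0) ltr_pdivlMr// ltNge.
  apply: contra sab; rewrite ler_norml => /andP[? ?]; apply/andP; split; lra.
have Kt_int (F : R -> R) : \int[mu]_(s in `[a, b]) (Kt s * F s) = \int[mu]_s (Kt s * F s).
  by rewrite [RHS](@Rintegral_restrict _ _ `[a, b])// => s /Kt0 ->; rewrite mul0r.
(* The unit mass of [K] reproduces the averaged term exactly. *)
have Kt1 : \int[mu]_(s in `[a, b]) (Kt s * hb) = hb.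
  rewrite Kt_int Rintegral_scaled_kernel//; first by rewrite RintegralZr// K1 mul1r.
  by apply: (integrableM_bounded (M := `|hb|)).
have osc : `|\int[mu]_(s in `[a, b]) (Kt s * G (s / eps))| <= D0 * V * (eps / tau) ^+ r.+1.
  rewrite Kt_int (Rintegral_scaled_kernel (h := fun s => G (s / eps)))//; last first.
    apply: (integrableM_bounded (M := 2 * c1 * V)) => //.
    apply: continuous_measurable_fun => u.
    apply: (@continuous_comp _ _ _ (fun u : R => ta + tau * u) (fun s => G (s / eps))).
      by apply: derivable_continuous; apply: derivableD => //; exact: derivableM.
    exact: contdiv.
  have l0 : 0 < tau / eps by rewrite divr_gt0.
  have := weak_kernel_oscillation K0 wd bv (ta / eps) l0 cG Gp G_le G0.
  rewrite (_ : (fun u => K u * G (ta / eps + _)) =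
               (fun u => K u * G ((ta + tau * u) / eps))); last first.
    by apply/funext => u; congr (_ * G _); field; rewrite lt0r_neq0.
  move/le_trans; apply.
  rewrite -exprVn invf_div; set eta := (eps / tau) ^+ r.+1.
  have eta0 : 0 <= eta by rewrite exprn_ge0// divr_ge0// ltW.
  rewrite (_ : 2 ^+ r.+1 * fine _ * _ * eta =
    fine (total_variation_line g) * (2 ^+ r.+1 * (2 * c1 * V) * eta)); last by ring.
  rewrite (_ : D0 * V * eta = TV * (2 ^+ r.+1 * (2 * c1 * V) * eta)); last first.
    by rewrite /D0 (ger0_norm c10); ring.
  by rewrite ler_wpM2r ?ler_norm// !mulr_ge0// exprn_ge0.
have KW : `|\int[mu]_(s in `[a, b]) (Kt s * W s)| <= w * k1.
  have -> : k1 = \int[mu]_(s in `[a, b]) `|Kt s|.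
    rewrite -(@Rintegral_restrict _ (fun s => `|Kt s|)) => [|s /Kt0 ->]; last by rewrite normr0.
    transitivity (\int[mu]_u (`|K u| * 1)); first by apply: eq_Rintegral => u _; rewrite mulr1.
    rewrite -(@Rintegral_scaled_kernel (fun u => `|K u|) tau ta (fun=> 1))//.
      apply: eq_Rintegral => s _.
      by rewrite mulr1 /Kt /scaled_kernel normrM gtr0_norm// invr_gt0.
    rewrite (_ : EFin \o _ = EFin \o (fun u => `|K u|)); last first.
      by apply/funext => u /=; rewrite mulr1.
    exact: integrable_norm.
  apply: Rintegral_bounded => //.
  apply: measurable_funD => //.
  by apply: measurable_funTS; apply: continuous_measurable_fun; exact: contdiv.
have fEi : f i 0 = \int[mu]_(s in `[a, b]) (Kt s * dm s i 0) by rewrite fE mxE.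
(* Under the kernel, [dm + hb = W - G]: a small part and an oscillating part. *)
have -> : (f + avg_field H ta *m v) i 0 =
    \int[mu]_(s in `[a, b]) (Kt s * W s) - \int[mu]_(s in `[a, b]) (Kt s * G (s / eps)).
  rewrite mxE -/hb -{1}Kt1 fEi.
  have mGe : measurable_fun `[a, b] (fun s : R => G (s / eps)).
    by apply: measurable_funTS; apply: continuous_measurable_fun; exact: contdiv.
  have mW : measurable_fun `[a, b] W.
    apply: measurable_funD => //.
    by apply: measurable_funTS; apply: continuous_measurable_fun; exact: contdiv.
  rewrite -RintegralD//; first last.
  - by apply: (integrableM_bounded (M := `|hb|)).
  - apply: (integrableM_bounded (M := c1 * V)) => // s sab.
    by have [_ /(_ i) []] := flow s sab.
  rewrite -RintegralB//; first last.
  - by apply: (integrableM_bounded (M := 2 * c1 * V)).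
  - exact: (integrableM_bounded (M := w)).
  by apply: eq_Rintegral => s _; rewrite /W /G; ring.
apply: le_trans (ler_normB _ _) _; apply: le_trans (lerD KW osc) _.
rewrite qE -exprnP; set eta := (eps / tau) ^+ r.+1.
have eta0 : 0 <= eta by rewrite exprn_ge0// divr_ge0// ltW.
rewrite (_ : w * k1 = A0 * V * tau); last by rewrite /w /A0 (ger0_norm c10); ring.
have h1 : 0 <= A0 * V * eta by rewrite !mulr_ge0.
have h2 : 0 <= D0 * V * tau by rewrite !mulr_ge0// ltW.
rewrite -subr_ge0 (_ : _ - _ = A0 * V * eta + D0 * V * tau) ?addr_ge0//.
by ring.
Qed.

End flux.

(** * Global error estimate *)

Theorem theorem3 (R : realType) (p : nat) (q : int) (K : R -> R)
    (H : R -> R -> 'M[R]_3) (c1 gamma C1 : R) :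
  kernel_class p q K ->
  0 < gamma ->
  let kappa := 1 + 2 * c1 * gamma + 2 * C1 * gamma in
  exists C : R, forall T : R,
    0 < T ->
    admissible_field T c1 H ->
    forall (N : nat) (eps tau : R),
    (1 <= N)%N ->
    let dt := T / N%:R in
    let tmid (n : nat) := (n%:R * dt + n.+1%:R * dt) / 2 in
    dt <= 2 / (3 * kappa) ->
    0 < eps -> eps < tau -> tau < dt -> eps < 1 ->
    forall F : R -> 'cV[R]_3 -> 'cV[R]_3,
    (forall (ta : R) (v : 'cV[R]_3),
       0 <= ta - tau / 2 -> ta + tau / 2 <= T ->
       is_upscaled_flux H K eps tau ta v (F ta v)) ->
    forall M mbar : nat -> 'cV[R]_3,
    (forall n : nat, (n < N)%N ->
       M n.+1 = M n + dt *: F (tmid n) (midpt M n)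
                + (gamma * dt) *: cross (midpt M n) (F (tmid n) (midpt M n))) ->
    (forall n : nat, (n < N)%N ->
       mbar n.+1 = mbar n - dt *: (avg_field H (tmid n) *m midpt mbar n)
                   + dt *: Ngamma gamma H (tmid n) (midpt mbar n)) ->
    M 0%N = mbar 0%N ->
    enorm (M 0%N) = 1 ->
    let e (n : nat) := M n - mbar n in
    (forall n : nat, (n < N)%N -> enorm (midpt M n) <= C1) ->
    (forall (n : nat) (theta : R), (n < N)%N -> 0 <= theta <= 1 ->
       dot (jacobian_mx (Ngamma gamma H (tmid n))
              (midpt mbar n + theta *: midpt e n) *m midpt e n) (midpt e n)
       <= gamma * c1 * enorm (midpt e n) ^+ 2) ->
    enorm (e N) <= C * Num.sqrt T * (tau + (eps / tau) ^ (q + 2))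
                   * expR (3 * kappa / 4 * T)
                   * \big[Num.max/0]_(n < N) enorm (midpt M n).
Proof.
move=> hK g0 kappa; have [C0 C00 flux] := flux_consistency c1 hK.
(* Square root of the factor [3 / 2 * B] in [gronwall], with [B = (1 + gamma * C1) * eta ^+ 2] and
   [eta] proportional to [C0]. *)
exists (Num.sqrt (3 / 2 * (1 + gamma * C1)) * C0) => T T0 admH N eps tau N1 dt tmid.
move=> dtk eps0 epstau taudt _ F HF M mbar HM Hmbar M0 M0n e MC1 jac.
have tau0 : 0 < tau := lt_trans eps0 epstau.
have N0 : 0 < N%:R :> R by rewrite ltr0n.
have dt0 : 0 < dt by rewrite divr_gt0.
have TE : T = N%:R * dt by rewrite mulrC divfK// lt0r_neq0.
have c10 := admissible_field_ge0 T0 admH.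
have C10 : 0 <= C1 by apply: le_trans (MC1 0%N N1); exact: enorm_ge0.
have k0 : 0 < kappa by rewrite /kappa -addrA ltr_pwDl// addr_ge0// !mulr_ge0// ltW.
have tmidE n : tmid n = n%:R * dt + dt / 2.
  by rewrite /tmid -natr1; field.
(* Since [tau < dt], the averaging window around each midpoint stays inside its time step, hence
   inside [[0, T]]. *)
have tmid_ge n : 0 <= tmid n - tau / 2.
  have : 0 <= n%:R * dt by rewrite mulr_ge0// ltW.
  by rewrite tmidE; lra.
have tmid_le n : (n < N)%N -> tmid n + tau / 2 <= T.
  move=> nN; have : n.+1%:R * dt <= N%:R * dt by rewrite ler_pM2r// ler_nat.
  by rewrite tmidE -TE -natr1 mulrDl; lra.
set Mx := \big[Num.max/0]_(n < N) _.
have Mx_ge n : (n < N)%N -> enorm (midpt M n) <= Mx.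
  move=> nN; exact: (@le_bigmax _ _ _ 0 (fun n : 'I_N => enorm (midpt M n)) (Ordinal nN)).
have Mx0 : 0 <= Mx by apply: le_trans (Mx_ge 0%N N1); exact: enorm_ge0.
set E := tau + (eps / tau) ^ (q + 2).
have E0 : 0 <= E by rewrite addr_ge0 ?(ltW tau0)// exprz_ge0// divr_ge0// ltW.
pose eta := C0 * E * Mx.
have eta0 : 0 <= eta by rewrite !mulr_ge0.
(* Replacing [F] by [d - avg_field H *m M] turns the scheme for [M] into the averaged scheme with
   perturbation [d] plus [gamma] times the cross product of [M] and [d]. *)
pose d n := F (tmid n) (midpt M n) + avg_field H (tmid n) *m midpt M n.
have d_le n : (n < N)%N -> enorm (d n) <= eta.
  move=> nN; apply: (@le_trans _ _ (C0 * E * enorm (midpt M n))).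
    apply: flux T0 admH eps0 tau0 (tmid_ge n) (tmid_le n nN) _.
    by apply: HF; [exact: tmid_ge|exact: tmid_le].
  by rewrite ler_wpM2l ?Mx_ge// mulr_ge0.
have step n : (n < N)%N ->
    dot (e n.+1) (e n.+1) * (1 - kappa * dt / 2) <=
    dot (e n) (e n) * (1 + kappa * dt / 2) + dt * ((1 + gamma * C1) * eta ^+ 2).
  move=> nN; have tT : tmid n \in `[0, T].
    rewrite in_itv/=; have := tmid_ge n; have := tmid_le n nN => ? ?.
    by apply/andP; split; lra.
  apply: (@error_step _ gamma c1 C1 dt eta kappa (avg_field H (tmid n))
    _ _ (midpt M n) (midpt mbar n) (d n)) => //.
  - exact: ltW.
  - by move=> v; exact: (avg_field_skew admH).
  - by rewrite /e /midpt -scalerDr; congr (_ *: _); rewrite addrACA !subrK.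
  - rewrite {1 2}/e HM// Hmbar// /Ngamma /cross_quad /d -/(midpt e n).
    have -> : midpt e n = midpt M n - midpt mbar n.
      by rewrite /e /midpt -scalerBr opprD addrACA.
    rewrite mulmxBr; set fl := F _ _; set X := _ *m midpt M n; set Y := _ *m midpt mbar n.
    by apply: cV3P; rewrite !(crossE, mxE); ring.
  - exact: MC1.
  - exact: d_le.
  - by apply: (jac n 2^-1) => //; apply/andP; split; lra.
have e0 : dot (e 0%N) (e 0%N) = 0.
  by rewrite /e M0 subrr dotE !mxE !mul0r !addr0.
have B0 : 0 <= (1 + gamma * C1) * eta ^+ 2.
  by rewrite mulr_ge0 ?sqr_ge0// addr_ge0// mulr_ge0// ltW.
(* The step restriction, which is [x <= 1 / 3] in [gronwall]. *)
have kdt : kappa * dt <= 2 / 3.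
  rewrite mulrC -ler_pdivlMr//; apply: le_trans dtk _.
  by rewrite invfM mulrA.
have := gronwall k0 (ltW dt0) kdt B0 e0 (fun n => dot_ge0 (e n)) step.
rewrite -TE => bound.
(* The bound concerns the squared error: the square root turns [T] into [Num.sqrt T] and halves the
   exponent to [3 * kappa / 4 * T]. *)
apply: enorm_le.
  by rewrite !mulr_ge0 ?expR_ge0 ?sqrtr_ge0.
apply: le_trans bound _.
rewrite le_eqVlt; apply/orP; left; apply/eqP.
have ex : expR (3 * kappa / 2 * T) = expR (3 * kappa / 4 * T) ^+ 2.
  by rewrite -expRM_natl; congr expR; field.
rewrite !exprMn !sqr_sqrtr ?(ltW T0)//; last first.
  by rewrite mulr_ge0 ?divr_ge0// addr_ge0// mulr_ge0// ltW.
by rewrite ex /eta; ring.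
Qed.
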